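(* Fix $C_\star>0$, $d\ge 2$, $q\ge1$ and $p\in[0,1]$. There exists $n_0$ such that for all $n\ge n_0$ and every boundary condition $\xi$ on $\Lambda_n$: if the random-cluster model on $\Lambda_n^\xi$ has SSM with constant $C_\star$, then the mixing time of the continuous-time FK dynamics on $\Lambda_n^\xi$ is $O(\log N)$ (equivalently, the mixing time of the discrete-time FK dynamics on $\Lambda_n^\xi$ is $O(N\log N)$), where $N=n^d$. Here $n_0$ and the implied constant depend only on $C_\star,p,q,d$.
   Context: Random-cluster model: for a finite graph $G=(V,E)$, $p\in[0,1]$, $q\ge1$, $\pi_{G,p,q}(\omega)\propto p^{|\omega|}(1-p)^{|E|-|\omega|}q^{|\mathrm{Comp}(\omega)|}$, $\omega\subseteq E$, with $\mathrm{Comp}(\omega)$ the set of connected components of $(V,\omega)$. $\Lambda_n=[-\frac n2,\frac n2]^d\cap\mathbb Z^d$ with its nearest-neighbor edges $E(\Lambda_n)$; $\partial\Lambda_n$ is the set of vertices of $\Lambda_n$ having a neighbor in $\mathbb Z^d\setminus\Lambda_n$. A boundary condition $\xi$ is a partition of $\partial\Lambda_n$; $\pi_{\Lambda_n^\xi}$ is defined in the same way with $\mathrm{Comp}(\omega)$ replaced by $\mathrm{Comp}(\omega;\xi)$, the components after identifying vertices in the same class of $\xi$. For $e\in E(\Lambda_n)$, $B_{m,e}$ is the graph with vertex set $\{v\in\Lambda_n:d_\infty(v,e)\le m\}$ and the induced edges. For a configuration $\eta$ on $E(\Lambda_n)\setminus E(B_{m,e})$, $B_{m,e}^\eta$ denotes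 $B_{m,e}$ with the boundary condition induced by $\eta$ together with $\xi$ (vertices are identified iff they are connected through $\eta$ and the identifications of $\xi$). $B_{m,e}^{\mathbf 1}$ and $B_{m,e}^{\mathbf 0}$ correspond to $\eta$ all open and all closed, respectively. SSM with constant $C$ on $\Lambda_n^\xi$: for all $e\in E(\Lambda_n)$ and all $m\le n/2$, $\|\pi_{B_{m,e}^{\mathbf 1}}(\omega(B_{m/2,e})\in\cdot)-\pi_{B_{m,e}^{\mathbf 0}}(\omega(B_{m/2,e})\in\cdot)\|_{TV}\le Ce^{-m/C}$. FK dynamics on $\Lambda_n^\xi$, continuous time: each edge $e$ has an independent rate-1 Poisson clock; when it rings, given the current $\omega$, $e$ becomes open with probability $\frac{p}{q(1-p)+p}$ if $|\mathrm{Comp}(\omega\setminus\{e\};\xi)|\ne|\mathrm{Comp}(\omega\cup\{e\};\xi)|$ and with probability $p$ otherwise; else it becomes closed. In discrete time, one uniformly random edge is updated by this rule at each step. The mixing time is the least $t$ such that $\max_{x_0}\|\mathbb P(X_t^{x_0}\in\cdot)-\pi\|_{TV}\le 1/4$. *)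

(* Defs.v *)
From HB Require Import structures.
From mathcomp Require Import all_boot all_order all_algebra.
From mathcomp Require Import all_classical all_reals all_analysis.
From mathcomp Require Import zify.

Set Implicit Arguments.
Unset Strict Implicit.
Unset Printing Implicit Defensive.

Import Order.TTheory GRing.Theory Num.Theory.
Import numFieldNormedType.Exports.

Local Open Scope ring_scope.

(** * Distributions and kernels on a finite type *)

Section FiniteChains.
Variables (R : realType) (T : finType).
Implicit Types (mu nu : T -> R) (K : T -> T -> R).

Definition tv_dist mu nu : R :=
  \big[Num.max/0]_(A : {set T}) `|\sum_(x in A) mu x - \sum_(x in A) nu x|.

Definition kernel_mx K : 'M[R]_#|T| :=
  \matrix_(i, j) K (enum_val i) (enum_val j).

Definition kernel_pow K (k : nat) (x y : T) : R :=
  (kernel_mx K ^+ k) (enum_rank x) (enum_rank y).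

(* Entry (x, y) of exp(t L): when L is the generator of a continuous-time chain
   on T, this is the probability to be at y at time t when started at x. *)
Definition semigroup (L : T -> T -> R) (t : R) (x y : T) : R :=
  limn (series (fun k => t ^+ k / k`!%:R * kernel_pow L k x y)).

End FiniteChains.

(** * The random-cluster model and its dynamics *)

(* [V] and [E] are the vertices and the edges of an ambient finite graph, the
   edge [e] joining the two elements of [ends e]. A configuration is the set of
   its open edges; a boundary condition is a set [xi] of disjoint blocks of
   vertices, vertices outside of all the blocks not being identified to any
   other. The model lives on the subgraph with vertices [W] and edges [F]. *)
Section RandomCluster.
Variables (R : realType) (V E : finType) (ends : E -> {set V}) (p q : R).
Implicit Types (W : {set V}) (F omega : {set E}) (xi : {set {set V}}).

Definition wired_adj omega xi : rel V := fun u v =>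
  [exists e in omega, ends e == [set u; v]%SET] || (v \in finset.pblock xi u).

(* |Comp(omega; xi)|: identifying the vertices of a block and linking them
   directly give the same number of components. *)
Definition ncomp W omega xi : nat := n_comp (wired_adj omega xi) W.

Definition rc_weight W F xi omega : R :=
  p ^+ #|omega| * (1 - p) ^+ (#|F| - #|omega|) * q ^+ ncomp W omega xi.

Definition rc_measure W F xi omega : R :=
  if omega \subset F then
    rc_weight W F xi omega /
      \sum_(omega' : {set E} | omega' \subset F) rc_weight W F xi omega'
  else 0.

(* The law of the restriction of omega to F *)
Definition marginal (mu : {set E} -> R) F (eta : {set E}) : R :=
  \sum_(omega : {set E} | omega :&: F == eta) mu omega.

(* The boundary condition induced on [W] by [eta] together with [xi] *)
Definition induced_bc W eta xi : {set {set V}} :=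
  equivalence_partition (connect (wired_adj eta xi)) W.

Variable xi : {set {set V}}.

Definition open_prob omega (e : E) : R :=
  if ncomp [set: V] (omega :\ e) xi != ncomp [set: V] (e |: omega) xi
  then p / (q * (1 - p) + p) else p.

Definition edge_update (e : E) (omega omega' : {set E}) : R :=
  open_prob omega e * (omega' == e |: omega)%:R
  + (1 - open_prob omega e) * (omega' == omega :\ e)%:R.

Definition fk_step (omega omega' : {set E}) : R :=
  #|E|%:R^-1 * \sum_(e : E) edge_update e omega omega'.

(* Rate-1 Poisson clocks: each edge is updated at rate 1. *)
Definition fk_generator (omega omega' : {set E}) : R :=
  \sum_(e : E) (edge_update e omega omega' - (omega' == omega)%:R).

Definition stationary : {set E} -> R := rc_measure [set: V] [set: E] xi.

Definition worst_tv (law : {set E} -> {set E} -> R) : R :=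
  \big[Num.max/0]_(x0 : {set E}) tv_dist (law x0) stationary.

(* The infimum is taken in the extended reals: it is +oo if the chain never
   gets within distance 1/4 of stationarity. *)
Definition tmix_discrete : \bar R :=
  ereal_inf [set t%:R%:E | t in
    [set t : nat | worst_tv (kernel_pow fk_step t) <= 4^-1]]%classic.

Definition tmix_continuous : \bar R :=
  ereal_inf [set t%:E | t in
    [set t : R | 0 <= t /\ worst_tv (semigroup fk_generator t) <= 4^-1]]%classic.

End RandomCluster.

(** * The boxes of the integer lattice *)

Definition Zd (d : nat) := {ffun 'I_d -> int}.

Definition Zd_adj d : rel (Zd d) := fun x y =>
  (\sum_(i < d) `|x i - y i| == 1)%N.

Definition in_box d n (x : Zd d) : bool := [forall i, 2 * `|x i| <= n]%N.

(* The vertices of the box [-n/2, n/2]^d, with coordinates shifted by the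
   integer part of n/2 so as to be nonnegative. *)
Definition vert (d n : nat) : finType := {ffun 'I_d -> 'I_(n./2.*2.+1)}.

Definition pt d n (v : vert d n) : Zd d :=
  [ffun i => (v i : nat)%:Z - (n./2)%:Z].

Lemma pt_inj d n : injective (@pt d n).
Proof.
move=> u v /ffunP uv; apply/ffunP => i; apply/val_inj.
by have := uv i; rewrite !ffunE => /addIr [].
Qed.

Lemma in_boxP d n (x : Zd d) :
  reflect (exists v : vert d n, x = pt v) (in_box n x).
Proof.
apply: (iffP forallP) => [xn|[v ->] i].
  have xn' i : (`|x i| <= n./2)%N by have := xn i; lia.
  exists [ffun i => inord `|(x i + (n./2)%:Z)%R|%N].
  apply/ffunP => i; move: (xn' i); rewrite !ffunE.
  move: (x i) (n./2) => /= z k zk.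
  by rewrite inordK; lia.
by rewrite ffunE; have := ltn_ord (v i); have := odd_double_half n; lia.
Qed.

Section Box.
Variables (d n : nat).
Local Notation V := (vert d n).

Definition box_adj : rel V := fun u v => Zd_adj (pt u) (pt v).

Definition box_edges : {set {set V}} :=
  [set [set u; v]%SET | u in V, v in V & box_adj u v]%SET.

Definition edge : finType := {e : {set V} | e \in box_edges}.

Definition box_ends (e : edge) : {set V} := val e.

Definition box_boundary : {set V} :=
  [set v : V | `[< exists y : Zd d, Zd_adj (pt v) y /\ ~~ in_box n y >]]%SET.

Definition dist_infty (u v : V) : nat :=
  (\max_(i < d) `|pt u i - pt v i|)%N.

(* The vertices of B_{r,e}; the distance to an edge is the least distance to
   one of its endpoints. *)
Definition ball_vert (r : nat) (e : edge) : {set V} :=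
  [set v : V | [exists u in box_ends e, dist_infty v u <= r]%N]%SET.

Definition ball_edges (r : nat) (e : edge) : {set edge} :=
  [set f : edge | box_ends f \subset ball_vert r e]%SET.

Variables (R : realType) (p q : R) (xi : {set {set V}}).

(* The random-cluster measure on B_{m,e}^eta *)
Definition ball_measure (m : nat) (e : edge) (eta : {set edge}) :
    {set edge} -> R :=
  let W := ball_vert m e in
  rc_measure box_ends p q W (ball_edges m e) (induced_bc box_ends W eta xi).

(* Distances being integers, B_{m/2,e} is the ball of radius [m./2]. *)
Definition SSM (C : R) : Prop :=
  forall (e : edge) (m : nat), (2 * m <= n)%N ->
    tv_dist
      (marginal (ball_measure m e (~: ball_edges m e)) (ball_edges m./2 e))
      (marginal (ball_measure m e finset.set0) (ball_edges m./2 e))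
    <= C * expR (- (m%:R / C)).

End Box.

(* Main.v *)
Require Import Defs.
From mathcomp Require Import all_boot all_order all_algebra.
From mathcomp Require Import all_classical all_reals all_analysis.
From mathcomp Require Import ring lra zify.

Set Implicit Arguments.
Unset Strict Implicit.
Unset Printing Implicit Defensive.

Import mathcomp.boot.fintype mathcomp.boot.finset mathcomp.boot.fingraph.
Import Order.TTheory GRing.Theory Num.Theory.
Import numFieldNormedType.Exports.

Local Open Scope ring_scope.

(** The heat-bath dynamics is monotone, so everything is controlled by the
    discrepancy [gap k e]: the difference of the probabilities that [e] is open
    after [k] steps of the discrete-time dynamics started from the all-open and
    the all-closed configurations. The distance to stationarity after [k] steps
    is at most twice the sum of [gap k e] over the edges
    ([stepn_stationary_le]), so it is enough to make [gap k e] a small multiple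
    of [1 / #|E|] within [O(log n)] sweeps, a sweep being [#|E|] steps.

    Connectivity makes the updates non-local, so there is no bound on the speed
    at which information travels. The key inequality ([gap_add]) avoids the need
    for one: with [B] the ball of radius [m] around [e],
      [gap (s + t) e <= #|B| * max gap s * max gap t + C exp(- m / C)].
    At time [s] the two extreme chains sandwich a stationary configuration [w].
    If they differ in [B], which costs [#|B| * max gap s], then after [t] more
    steps they differ at [e] with probability at most [gap t e], by
    monotonicity. If they agree with [w] in [B], then the dynamics in [B] with
    everything open (resp. closed) outside, both started from [w], sandwich them
    from then on. But the stationary law is dominated by that of the wired ball,
    which is invariant: the wired dynamics started from [w] opens [e] with
    probability at most that of the wired ball at equilibrium, whatever [t] is;
    likewise from below. Spatial mixing bounds the difference of these two
    equilibrium probabilities ([ssm_opened]).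

    In a ball of fixed radius the wired dynamics coalesces geometrically fast in
    the number of sweeps ([stepn_contract]): with spatial mixing this makes the
    discrepancy as small as desired after a fixed number of sweeps
    ([gap_sweeps]). Doubling the time and the radius together then squares the
    discrepancy at each round ([gap_decay]), so that after [2 ^ j] times this
    number of sweeps it is at most [exp(- 2 ^ j)], as long as the radius is at most
    [n / 2]. This reaches any power of [1 / n] when [2 ^ j] is of order [log n].

    Coalescence relies on openings, hence on [0 < p]; when [p = 0] an edge closes
    for good at its first update ([gap_p0]).

    The measures on the balls are invariant for the dynamics of the whole graph
    frozen outside of the ball, because an edge of the ball merges two components
    of the ball with its induced boundary condition exactly when it merges two
    components of the whole graph ([ncomp_induced_drop], [invariant_extend]). The
    continuous-time semigroup is a Poisson average of the powers of the
    discrete-time kernel ([semigroup_poisson]), which transfers the bound to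
    continuous time. *)

(** * Means and increasing functions of a set *)

Section Means.
Variables (R : realType) (E : finType).
Implicit Types (g h : {set E} -> R) (mu nu : {set E} -> R) (w x y B : {set E}).

Definition increasing g := forall w w', w \subset w' -> g w <= g w'.

Definition mean mu g : R := \sum_w mu w * g w.

Definition is_prob mu := (forall w, 0 <= mu w) /\ \sum_w mu w = 1.

Definition dominates mu nu := forall g, increasing g -> mean nu g <= mean mu g.

Definition opened (e : E) w : R := (e \in w)%:R.

Lemma increasing_opened e : increasing (opened e).
Proof.
move=> w w' /subsetP ww'; rewrite /opened ler_nat.
by case: (boolP (e \in w)) => // /ww' ->.
Qed.

Lemma eq_mean mu g h : g =1 h -> mean mu g = mean mu h.
Proof. by move=> gh; apply: eq_bigr => w _; rewrite gh. Qed.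

Lemma meanB mu g h : mean mu (fun w => g w - h w) = mean mu g - mean mu h.
Proof.
by rewrite /mean -sumrB; apply: eq_bigr => w _; rewrite mulrBr.
Qed.

Lemma meanZ mu c g : mean mu (fun w => c * g w) = c * mean mu g.
Proof. by rewrite /mean mulr_sumr; apply: eq_bigr => w _; rewrite mulrCA. Qed.

Lemma mean_sum mu (I : finType) (A : {pred I}) (G : I -> {set E} -> R) :
  mean mu (fun w => \sum_(i in A) G i w) = \sum_(i in A) mean mu (G i).
Proof.
rewrite /mean exchange_big /=; apply: eq_bigr => w _.
by rewrite mulr_sumr.
Qed.

Lemma mean_cst mu c : is_prob mu -> mean mu (fun=> c) = c.
Proof. by move=> [_ mu1]; rewrite /mean -mulr_suml mu1 mul1r. Qed.

Lemma ler_mean mu g h : is_prob mu ->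
  (forall w, mu w != 0 -> g w <= h w) -> mean mu g <= mean mu h.
Proof.
move=> [mu0 _] gh; apply: ler_sum => w _.
by have [->|/gh] := eqVneq (mu w) 0; [rewrite !mul0r|exact: ler_wpM2l].
Qed.

Lemma mean_le mu g c : is_prob mu ->
  (forall w, mu w != 0 -> g w <= c) -> mean mu g <= c.
Proof. by move=> pmu gc; rewrite -[c](mean_cst c pmu); exact: ler_mean. Qed.

Lemma mean_ge mu g c : is_prob mu ->
  (forall w, mu w != 0 -> c <= g w) -> c <= mean mu g.
Proof. by move=> pmu gc; rewrite -[c](mean_cst c pmu); exact: ler_mean. Qed.

Lemma sum_opened B w : \sum_(e in B) opened e w = #|w :&: B|%:R.
Proof.
rewrite -sum1_card natr_sum [RHS](eq_bigl (fun e => (e \in B) && (e \in w))).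
  by rewrite big_mkcondr; apply: eq_bigr => e _; rewrite /opened; case: ifP.
by move=> e; rewrite inE andbC.
Qed.

Lemma sum_if_set B (F : E -> R) c :
  \sum_(e : E) (if e \in B then F e else c) =
  \sum_(e in B) F e + (#|E|%:R - #|B|%:R) * c.
Proof.
rewrite (bigID (mem B))/=; congr (_ + _); first by apply: eq_bigr => e ->.
rewrite (eq_bigr (fun=> c)) => [|e /negbTE -> //].
rewrite sumr_const -(mulr_natl c); congr (_ * c).
rewrite -natrB ?max_card//; congr (_%:R).
by rewrite -(cardsC B) addKn; apply: eq_card => e; rewrite inE.
Qed.

(** If [g] is [c]-Lipschitz in the elements of [B], then [c] times the number of
    elements in [B] becomes increasing when [g] is added or subtracted: hence
    domination controls [g] by the means of the single elements. *)
Lemma mean_lipschitz mu nu g c B :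
  dominates mu nu ->
  (forall w w', w \subset w' ->
     `|g w' - g w| <= c * (#|w' :&: B|%:R - #|w :&: B|%:R)) ->
  `|mean mu g - mean nu g| <=
    c * \sum_(e in B) (mean mu (opened e) - mean nu (opened e)).
Proof.
move=> dom gc.
have main h : (forall w w', w \subset w' ->
      h w' - h w <= c * (#|w' :&: B|%:R - #|w :&: B|%:R)) ->
    mean mu h - mean nu h <=
      c * \sum_(e in B) (mean mu (opened e) - mean nu (opened e)).
  move=> hc; pose h' w := c * (\sum_(e in B) opened e w) - h w.
  have incr_h' : increasing h'.
    by move=> w w' /hc; rewrite /h' !sum_opened; nra.
  have := dom _ incr_h'; rewrite /h' !meanB !meanZ !mean_sum sumrB.
  by move=> H; nra.
rewrite ler_norml lerNl; apply/andP; split; last first.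
  by apply: main => w w' /gc; rewrite ler_norml => /andP[].
have := main (fun w => -1 * g w); rewrite !meanZ => H.
rewrite opprB; apply: le_trans (H _); first by lra.
by move=> w w' /gc; rewrite ler_norml => /andP[]; lra.
Qed.

End Means.

Lemma one_sub_inv_expn (R : realType) n : (0 < n)%N ->
  (1 - n%:R^-1) ^+ n <= 2^-1 :> R.
Proof.
move=> n0; have nR : 0 < n%:R :> R by rewrite ltr0n.
have n1 : n%:R^-1 <= 1 :> R by rewrite invf_le1// ler1n.
apply: (@le_trans _ _ (expR (- n%:R^-1) ^+ n)).
  by rewrite lerXn2r ?nnegrE ?expR_ge0 ?subr_ge0//; exact: expR_ge1Dx.
rewrite -expRM_natl mulrN mulfV ?gt_eqF// expRN lef_pV2 ?posrE ?expR_gt0//.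
exact: expR_ge1Dx.
Qed.

Lemma le_add_geometric (R : realType) (r c x y : R) : 0 <= r < 1 ->
  (forall j, x <= y + c * r ^+ j) -> x <= y.
Proof.
move=> /andP[r0 r1] H.
have cv : ((fun j => y + c * r ^+ j) @ \oo --> y + 0)%classic.
  apply: cvgD; first exact: cvg_cst.
  by apply: cvg_geometric; rewrite ger0_norm.
rewrite addr0 in cv.
by apply: ler_cvg_to (cvg_cst x) cv _; exact: nearW.
Qed.

(** * Single-edge dynamics with increasing opening probabilities *)

Section MonotoneDynamics.
Variables (R : realType) (E : finType) (o : {set E} -> E -> R).
Hypothesis o01 : forall w e, 0 <= o w e <= 1.
Hypothesis o_incr : forall (w w' : {set E}) e, w \subset w' -> o w e <= o w' e.
Hypothesis E_gt0 : (0 < #|E|)%N.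
Implicit Types (g h : {set E} -> R) (w x y B S : {set E}).

Definition upd e g w := o w e * g (e |: w) + (1 - o w e) * g (w :\ e).

(** The edges outside of [B] are still selected, with no effect, so that the
    dynamics in [B] runs on the same clock as the full one, which is the case
    [B = E]. *)
Definition step B g w : R :=
  #|E|%:R^-1 * \sum_(e : E) (if e \in B then upd e g w else g w).

Definition stepn B k : ({set E} -> R) -> {set E} -> R := iter k (step B).

Definition law B k w y : R := stepn B k (fun w' => (w' == y)%:R) w.

Local Notation NE := (#|E|%:R : R).

Lemma NE_gt0 : 0 < NE. Proof. by rewrite ltr0n. Qed.
Hint Resolve NE_gt0 : core.

Lemma sum_NE c : NE^-1 * \sum_(e : E) c = c.
Proof.
by rewrite sumr_const -(mulr_natl c) mulrA mulVf ?mul1r// gt_eqF.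
Qed.

Lemma upd_le e g h w w' : w \subset w' ->
  g (e |: w) <= h (e |: w') -> g (w :\ e) <= h (w' :\ e) ->
  g (w :\ e) <= h (e |: w') -> upd e g w <= upd e h w'.
Proof.
move=> ww' g1 g0 g01; rewrite /upd.
move: (o_incr e ww') (o01 w e) (o01 w' e) => oww /andP[a0 _] /andP[_ b1].
by nra.
Qed.

Lemma upd_le_cst e g c w : g (e |: w) <= c -> g (w :\ e) <= c -> upd e g w <= c.
Proof. by rewrite /upd; have /andP[] := o01 w e; nra. Qed.

Lemma upd_ge_cst e g c w : c <= g (e |: w) -> c <= g (w :\ e) -> c <= upd e g w.
Proof. by rewrite /upd; have /andP[] := o01 w e; nra. Qed.

Lemma step_le_step B B' g h w w' :
  (forall e, (if e \in B then upd e g w else g w) <=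
             (if e \in B' then upd e h w' else h w')) ->
  step B g w <= step B' h w'.
Proof. by move=> H; rewrite /step ler_pM2l ?invr_gt0//; exact: ler_sum. Qed.

Lemma stepS B k g w : stepn B k.+1 g w = step B (stepn B k g) w.
Proof. by []. Qed.

Lemma stepnD B s t g : stepn B (s + t) g = stepn B s (stepn B t g).
Proof. exact: iterD. Qed.

Lemma step_eq B g h : g =1 h -> step B g =1 step B h.
Proof.
move=> gh w; rewrite /step; congr (_ * _); apply: eq_bigr => e _.
by rewrite /upd !gh.
Qed.

Lemma stepn_eq B k g h : g =1 h -> stepn B k g =1 stepn B k h.
Proof. by move=> gh; elim: k => //= k IH w; exact: step_eq. Qed.

Lemma step_sum B (c : {set E} -> R) (G : {set E} -> {set E} -> R) w :
  step B (fun w' => \sum_y G y w' * c y) w = \sum_y step B (G y) w * c y.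
Proof.
rewrite /step /upd.
under [RHS]eq_bigr => y _ do rewrite -mulrA mulr_suml.
rewrite -mulr_sumr. congr (_ * _). rewrite exchange_big /=.
apply: eq_bigr => e _; case: ifP => _ //.
rewrite !mulr_sumr -big_split /=; apply: eq_bigr => y _.
by rewrite [RHS]mulrDl !mulrA.
Qed.

Lemma stepnE B k g w : stepn B k g w = mean (law B k w) g.
Proof.
rewrite /mean /law; elim: k w => [|k IH] w.
  rewrite /= (bigD1 w)//= eqxx mul1r big1 ?addr0// => y yw.
  by rewrite eq_sym (negbTE yw) mul0r.
by rewrite stepS (step_eq B IH) step_sum.
Qed.

Lemma stepn_ge0 B k g : (forall w, 0 <= g w) -> forall w, 0 <= stepn B k g w.
Proof.
move=> g0; elim: k => [//|k IH] w; rewrite stepS /step.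
rewrite mulr_ge0 ?invr_ge0// sumr_ge0// => e _.
by case: ifP => _ //; exact: upd_ge_cst.
Qed.

Lemma stepn_cst B k c w : stepn B k (fun=> c) w = c.
Proof.
elim: k w => [//|k IH] w; rewrite stepS (step_eq B IH) /step.
rewrite -[RHS]sum_NE; congr (_ * _); apply: eq_bigr => e _.
by rewrite /upd -mulrDl subrKC mul1r if_same.
Qed.

Lemma is_prob_law B k w : is_prob (law B k w).
Proof.
split=> [y|]; first exact: stepn_ge0.
have := stepnE B k (fun=> 1) w; rewrite stepn_cst /mean => ->.
by apply: eq_bigr => y _; rewrite mulr1.
Qed.

Lemma stepn_ge_cst B k g c w : (forall w, c <= g w) -> c <= stepn B k g w.
Proof.
by move=> cg; rewrite stepnE; apply: mean_ge => //; exact: is_prob_law.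
Qed.

Lemma stepn_le_cst B k g c w : (forall w, g w <= c) -> stepn B k g w <= c.
Proof.
by move=> cg; rewrite stepnE; apply: mean_le => //; exact: is_prob_law.
Qed.

Lemma step_incr B g : increasing g -> increasing (step B g).
Proof.
move=> gi w w' ww'; apply: step_le_step => e; case: ifP => _; last exact: gi.
apply: upd_le => //; apply: gi.
- exact: setUS.
- exact: setSD.
- by rewrite subDset setUA setUid (subset_trans ww')// subsetUr.
Qed.

Lemma stepn_incr B k g : increasing g -> increasing (stepn B k g).
Proof. by move=> gi; elim: k => //= k IH; exact: step_incr. Qed.

(** Edges that are open outside of [B] only help: no update of the full
    dynamics can leave the wired dynamics in [B] behind. *)
Lemma stepn_le_wired B k g w : increasing g ->
  stepn [set: E] k g w <= stepn B k g (w :|: ~: B).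
Proof.
move=> gi; suff H w' : w \subset w' -> ~: B \subset w' ->
    stepn [set: E] k g w <= stepn B k g w'.
  by apply: H; rewrite ?subsetUl ?subsetUr.
elim: k w w' => [|k IH] w w' ww' Bw'; first exact: gi.
rewrite !stepS; apply: step_le_step => e; rewrite inE.
case: ifPn => eB.
  have B1 : ~: B \subset e |: w' by rewrite (subset_trans Bw')// subsetUr.
  apply: upd_le => //; apply: IH => //.
  - exact: setUS.
  - exact: setSD.
  - by rewrite subsetD1 Bw' inE eB.
  - by rewrite subDset setUA setUid (subset_trans ww')// subsetUr.
have ew' : e \in w' by rewrite (subsetP Bw')// inE.
apply: upd_le_cst; apply: IH => //.
  by rewrite subUset sub1set ew'.
by rewrite (subset_trans _ ww')// subsetDl.
Qed.

Lemma stepn_ge_free B k g w : increasing g ->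
  stepn B k g (w :&: B) <= stepn [set: E] k g w.
Proof.
move=> gi; suff H w' : w' \subset w -> w' \subset B ->
    stepn B k g w' <= stepn [set: E] k g w.
  by apply: H; rewrite ?subsetIl ?subsetIr.
elim: k w w' => [|k IH] w w' ww' Bw'; first exact: gi.
rewrite !stepS; apply: step_le_step => e; rewrite inE.
case: ifPn => eB.
  have B1 : w' :\ e \subset B by rewrite (subset_trans _ Bw')// subsetDl.
  apply: upd_le => //; apply: IH => //.
  - exact: setUS.
  - by rewrite subUset sub1set eB.
  - exact: setSD.
  - by rewrite subDset setUA setUid (subset_trans ww')// subsetUr.
have ew' : e \notin w' by apply: contra eB => /(subsetP Bw').
apply: upd_ge_cst; apply: IH => //.
  by rewrite (subset_trans ww')// subsetUr.
by rewrite subsetD1 ww'.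
Qed.

(** Configurations that agree outside of [B] keep doing so, hence functions need
    only be compared between the smallest and the largest of them. *)
Lemma stepn_le_interval B k g h x y : x \subset ~: B -> B \subset y ->
  (forall w, x \subset w -> w \subset y -> g w <= h w) ->
  forall w, x \subset w -> w \subset y -> stepn B k g w <= stepn B k h w.
Proof.
move=> xB By gh; elim: k => [//|k IH] w xw wy; rewrite !stepS.
apply: step_le_step => e; case: ifPn => eB; last exact: IH.
have ex : e \notin x by apply/negP => /(subsetP xB); rewrite inE eB.
have H1 : stepn B k g (e |: w) <= stepn B k h (e |: w).
  apply: IH; first by rewrite (subset_trans xw)// subsetUr.
  by rewrite subUset sub1set (subsetP By).
have H0 : stepn B k g (w :\ e) <= stepn B k h (w :\ e).
  apply: IH; first by rewrite subsetD1 xw.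
  by rewrite (subset_trans _ wy)// subsetDl.
by rewrite /upd; have /andP[] := o01 w e; nra.
Qed.

(** * Coalescence in a bounded number of sweeps *)

Section Coalescence.
Variable a : R.
Hypothesis a0 : 0 <= a.
Hypothesis a_le : forall w e, a <= o w e.

Definition all_open S w : R := (S \subset w)%:R.

Lemma all_open_ge0 S w : 0 <= all_open S w. Proof. exact: ler0n. Qed.

(** An edge of [S] opens with probability at least [a] when it is selected, which
    leaves only the rest of [S] to be open already. *)
Lemma step_all_open B S w : S \subset B ->
  (1 - #|S|%:R / NE) * all_open S w + a / NE * \sum_(e in S) all_open (S :\ e) w
    <= step B (all_open S) w.
Proof.
move=> SB.
have -> : (1 - #|S|%:R / NE) * all_open S w +
    a / NE * \sum_(e in S) all_open (S :\ e) w =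
    NE^-1 * \sum_(e : E) (if e \in S then a * all_open (S :\ e) w
                          else all_open S w).
  rewrite sum_if_set -mulr_sumr.
  have NE0 : NE != 0 by rewrite gt_eqF.
  by field.
rewrite /step ler_pM2l ?invr_gt0//; apply: ler_sum => e _.
case: ifPn => eS.
  rewrite (subsetP SB)// /upd /all_open -subDset.
  rewrite ler_wpDr ?mulr_ge0 ?ler_wpM2r ?ler0n ?subr_ge0//.
  by have /andP[] := o01 w e.
case: ifP => // _; rewrite /upd /all_open -subDset subsetD1 eS andbT.
have -> : S :\ e = S by apply/setDidPl; rewrite disjoint_sym disjoints1.
by rewrite -mulrDl subrKC mul1r.
Qed.

(** By induction on [S]: when the sets [S :\ e] are open with probability at least
    [(a / 2) ^+ n], the probability that [S] is open relaxes to at least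
    [a * (a / 2) ^+ n] at rate [#|S| / #|E|], and one sweep brings it at least half
    of the way. *)
Lemma stepn_all_open B S k w : S \subset B -> (#|S| * #|E| <= k)%N ->
  (a / 2) ^+ #|S| <= stepn B k (all_open S) w.
Proof.
move En : #|S| => n; elim: n S En k w => [|n IH] S Sn k w SB kS.
  rewrite expr0 (stepn_eq B k (h := fun=> 1)) ?stepn_cst// => w'.
  by rewrite /all_open (cards0_eq Sn) sub0set.
set u := (1 - n.+1%:R / NE : R).
have nN : n.+1%:R / NE <= 1.
  by rewrite ler_pdivrMr// mul1r ler_nat -Sn max_card.
have u0 : 0 <= u by rewrite subr_ge0.
have rec i w' : u * stepn B (n * #|E| + i) (all_open S) w' +
    a * (n.+1%:R / NE) * (a / 2) ^+ n <=
    stepn B (n * #|E| + i).+1 (all_open S) w'.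
  rewrite [leRHS](_ : _ = stepn B (n * #|E| + i) (step B (all_open S)) w');
    last by rewrite /stepn iterSr.
  have H := is_prob_law B (n * #|E| + i) w'.
  have := ler_mean H (fun w _ => step_all_open w SB).
  rewrite -!stepnE; apply: le_trans.
  rewrite [in leRHS]stepnE [leRHS](_ : _ = mean (law B (n * #|E| + i) w')
    (fun w => u * all_open S w - (- (a / NE)) * \sum_(e in S) all_open (S :\ e) w)).
    rewrite meanB !meanZ mean_sum -stepnE mulNr opprK.
    rewrite lerD2l -!mulrA ler_wpM2l// mulrCA ler_wpM2l ?invr_ge0//.
    rewrite mulr_natl -{1}Sn -sumr_const; apply: ler_sum => e eS.
    rewrite -stepnE; apply: IH; last exact: leq_addr.
      by have := cardsD1 e S; rewrite eS Sn; case.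
    by rewrite (subset_trans _ SB)// subsetDl.
  by apply: eq_mean => w0; rewrite mulNr opprK Sn.
have main i w' : a * (a / 2) ^+ n - stepn B (n * #|E| + i) (all_open S) w' <=
    u ^+ i * (a * (a / 2) ^+ n).
  elim: i => [|i IHi].
    rewrite expr0 mul1r gerBl; apply: stepn_ge_cst => *; exact: all_open_ge0.
  rewrite addnS; have := rec i w'; have := ler_wpM2l u0 IHi.
  by rewrite exprS /u; nra.
have ki : k = (n * #|E| + (k - n * #|E|))%N.
  by rewrite subnKC// (leq_trans _ kS)// leq_mul2r leqnSn orbT.
have {main} := main (k - n * #|E|)%N w; rewrite -ki.
have un : u ^+ (k - n * #|E|) <= 2^-1.
  have N1 : 1 - NE^-1 <= 1 by rewrite gerBl invr_ge0.
  have u1 : u <= 1 - NE^-1.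
    by rewrite lerB// ler_peMl ?invr_ge0// ler1n.
  have N0 := le_trans u0 u1.
  apply: le_trans (one_sub_inv_expn R E_gt0).
  apply: (@le_trans _ _ (u ^+ #|E|)); last by rewrite lerXn2r.
  rewrite ler_wiXn2l//; first exact: le_trans N1.
  by rewrite leq_subRL ?(leq_trans _ kS) ?leq_mul2r ?leqnSn ?orbT// addnC -mulSn.
have a2n : 0 <= a * (a / 2) ^+ n by rewrite mulr_ge0 ?exprn_ge0 ?divr_ge0.
by rewrite exprS => H; have := ler_wpM2r a2n un; nra.
Qed.

(** With probability bounded below, [b] sweeps open every edge of [B]; on this
    event the dynamics started from the two extreme configurations agree. *)
Lemma stepn_contract B b g x : (#|B| <= b)%N -> increasing g ->
  x \subset ~: B ->
  stepn B (b * #|E|) g (x :|: B) - stepn B (b * #|E|) g x <=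
    (1 - (a / 2) ^+ b) * (g (x :|: B) - g x).
Proof.
move=> Bb gi xB; set y := x :|: B; set k := (b * #|E|)%N.
have xy : x \subset y by exact: subsetUl.
have By : B \subset y by exact: subsetUr.
have gxy : 0 <= g y - g x by rewrite subr_ge0 gi.
have ub : stepn B k g y <= g y.
  rewrite -[leRHS](stepn_cst B k (g y) y).
  by apply: (stepn_le_interval _ xB By) => // w _; exact: gi.
have lb : g x + (a / 2) ^+ b * (g y - g x) <= stepn B k g x.
  apply: (@le_trans _ _ (stepn B k
      (fun w => (g y - g x) * all_open B w - - g x) x)).
    rewrite stepnE meanB meanZ mean_cst; last exact: is_prob_law.
    rewrite opprK addrC lerD2r mulrC ler_wpM2l// -stepnE.
    apply: (@le_trans _ _ ((a / 2) ^+ #|B|)).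
      rewrite ler_wiXn2l ?divr_ge0// ler_pdivrMr// mul1r.
      have [e _] : exists e : E, e \in predT by apply/card_gt0P.
      have /andP[_ oe] := o01 set0 e.
      by have := a_le set0 e; lra.
    by apply: stepn_all_open => //; rewrite leq_mul2r Bb orbT.
  apply: (stepn_le_interval _ xB By) => // w xw wy; rewrite /all_open opprK.
  case: (boolP (B \subset w)) => Bw; last by rewrite mulr0 add0r gi.
  rewrite mulr1 subrK (_ : w = y)//; apply/eqP.
  by rewrite eqEsubset wy subUset xw.
by nra.
Qed.

Lemma stepn_contract_iter B b g x j : (#|B| <= b)%N -> increasing g ->
  x \subset ~: B ->
  stepn B (j * (b * #|E|)) g (x :|: B) - stepn B (j * (b * #|E|)) g x <=
    (1 - (a / 2) ^+ b) ^+ j * (g (x :|: B) - g x).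
Proof.
move=> Bb gi xB; elim: j => [|j IH]; first by rewrite mul0n expr0 mul1r.
rewrite mulSn !stepnD exprS -mulrA.
have := stepn_contract Bb (stepn_incr B (j * (b * #|E|)) gi) xB.
move/le_trans; apply; apply: ler_wpM2l IH.
have [e _] : exists e : E, e \in predT by apply/card_gt0P.
have /andP[_ oe] := o01 set0 e; have ae := a_le set0 e.
by rewrite subr_ge0 exprn_ile1 ?divr_ge0// ler_pdivrMr// mul1r; lra.
Qed.



(** * The discrepancy between the extreme chains *)

Definition step_invariant B mu := forall g, mean mu (step B g) = mean mu g.

Lemma invariant_stepn B mu k g : step_invariant B mu ->
  mean mu (stepn B k g) = mean mu g.
Proof. by move=> inv; elim: k => // k IH; rewrite /stepn/= inv. Qed.

(** The law [mu] of the wired model is preserved by the wired dynamics, and is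
    above the law of the wired dynamics started from its smallest state. *)
Lemma wired_bound B mu g k : is_prob mu -> step_invariant B mu ->
  (forall w, mu w != 0 -> ~: B \subset w) -> increasing g ->
  stepn [set: E] k g [set: E] <=
    mean mu g + (stepn B k g [set: E] - stepn B k g (~: B)).
Proof.
move=> pmu inv supp gi.
have := stepn_le_wired B k [set: E] gi; rewrite setTU.
suff : stepn B k g (~: B) <= mean mu g by lra.
rewrite -(invariant_stepn k g inv); apply: mean_ge => // w /supp.
exact: stepn_incr.
Qed.

Lemma free_bound B mu g k : is_prob mu -> step_invariant B mu ->
  (forall w, mu w != 0 -> w \subset B) -> increasing g ->
  mean mu g - (stepn B k g B - stepn B k g set0) <=
    stepn [set: E] k g set0.
Proof.
move=> pmu inv supp gi.
have := stepn_ge_free B k set0 gi; rewrite set0I.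
suff : mean mu g <= stepn B k g B by lra.
rewrite -(invariant_stepn k g inv); apply: mean_le => // w /supp.
exact: stepn_incr.
Qed.

Section Stationary.
Variable pi : {set E} -> R.
Hypothesis pi_prob : is_prob pi.
Hypothesis pi_inv : step_invariant [set: E] pi.

Lemma law_setT_dominates k : dominates (law [set: E] k [set: E]) pi.
Proof.
move=> g gi; rewrite -stepnE -(invariant_stepn k g pi_inv).
by apply: mean_le => // w _; apply: stepn_incr (subsetT w).
Qed.

Lemma dominates_law_set0 k : dominates pi (law [set: E] k set0).
Proof.
move=> g gi; rewrite -stepnE -(invariant_stepn k g pi_inv).
by apply: mean_ge => // w _; apply: stepn_incr (sub0set w).
Qed.

Definition gap k e : R :=
  stepn [set: E] k (opened R e) [set: E] - stepn [set: E] k (opened R e) set0.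

Lemma gap_ge0 k e : 0 <= gap k e.
Proof.
rewrite subr_ge0; apply: stepn_incr (sub0set _).
exact: increasing_opened.
Qed.

Lemma gap_decr k l e : (k <= l)%N -> gap l e <= gap k e.
Proof.
move=> kl; rewrite -(subnKC kl) addnC /gap !stepnD.
have incr := stepn_incr [set: E] k (@increasing_opened R E e).
by apply: lerB; [apply: stepn_le_cst|apply: stepn_ge_cst] => w; apply: incr;
  rewrite ?subsetT ?sub0set.
Qed.

(** A function with values in [[0, 1]] is 1-Lipschitz in the number of open
    edges, and both the law at time [k] from [w] and the stationary law lie
    between the laws at time [k] from the two extreme configurations. *)
Lemma stepn_stationary_le k g w : (forall w, 0 <= g w <= 1) ->
  `|stepn [set: E] k g w - mean pi g| <= 2 * \sum_(e : E) gap k e.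
Proof.
move=> g01.
have lip (w1 w2 : {set E}) : w1 \subset w2 ->
    `|g w2 - g w1| <= 1 * (#|w2 :&: [set: E]|%:R - #|w1 :&: [set: E]|%:R).
  rewrite !setIT mul1r => w12.
  have := subset_leq_card w12; rewrite leq_eqVlt => /orP[/eqP c12|c12].
    have -> : w1 = w2 by apply/eqP; rewrite eqEcard w12 c12 /=.
    by rewrite !subrr normr0.
  have : 1 <= #|w2|%:R - #|w1|%:R :> R by rewrite -natrB ?ler1n ?subn_gt0// ltnW.
  have := g01 w1; have := g01 w2; rewrite ler_norml; lra.
have D1 (nu : {set E} -> R) : dominates (law [set: E] k [set: E]) nu ->
    (forall e, mean (law [set: E] k set0) (opened R e) <= mean nu (opened R e)) ->
    `|stepn [set: E] k g [set: E] - mean nu g| <= \sum_(e : E) gap k e.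
  move=> dom low; rewrite stepnE.
  apply: le_trans (mean_lipschitz dom lip) _.
  rewrite mul1r (eq_bigl predT) => [|e]; last by rewrite inE.
  by apply: ler_sum => e _; rewrite /gap 2!stepnE lerB.
have := D1 _ (law_setT_dominates k)
  (fun e => dominates_law_set0 k (@increasing_opened R E e)).
have : `|stepn [set: E] k g [set: E] - stepn [set: E] k g w| <=
    \sum_(e : E) gap k e.
  rewrite [in leLHS](stepnE _ _ _ w); apply: D1 => [h hi|e]; rewrite -!stepnE.
    exact: stepn_incr (subsetT w).
  by apply: stepn_incr (sub0set w); exact: increasing_opened.
by rewrite !ler_norml; lra.
Qed.

Section Recursion.
Variables (B : {set E}) (mu1 mu0 : {set E} -> R).
Hypotheses (mu1_prob : is_prob mu1) (mu1_inv : step_invariant B mu1).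
Hypothesis mu1_supp : forall w, mu1 w != 0 -> ~: B \subset w.
Hypotheses (mu0_prob : is_prob mu0) (mu0_inv : step_invariant B mu0).
Hypothesis mu0_supp : forall w, mu0 w != 0 -> w \subset B.

(** Wired and free dynamics in [B] sandwich the full one, and each of them is
    within [(1 - (a / 2) ^+ b) ^+ j] of its equilibrium. *)
Lemma gap_sweeps b j e : (#|B| <= b)%N ->
  gap (j * (b * #|E|)) e <= mean mu1 (opened R e) - mean mu0 (opened R e)
    + 2 * (1 - (a / 2) ^+ b) ^+ j.
Proof.
move=> Bb; set k := (j * _)%N; set r := _ ^+ j.
have fi := @increasing_opened R E e.
have f01 w : 0 <= opened R e w <= 1 by rewrite /opened ler0n lern1 leq_b1.
have r0 : 0 <= r.
  rewrite exprn_ge0// subr_ge0 exprn_ile1 ?divr_ge0// ler_pdivrMr// mul1r.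
  have /andP[_ oe] := o01 set0 e; have ae := a_le set0 e; lra.
have D x : x \subset ~: B -> stepn B k (opened R e) (x :|: B) -
    stepn B k (opened R e) x <= r.
  move=> xB; apply: le_trans (stepn_contract_iter j Bb fi xB) _.
  rewrite -/r -[leRHS]mulr1 ler_wpM2l//.
  by have /andP[_] := f01 (x :|: B); have /andP[] := f01 x; lra.
have := D _ (subxx _); have := D _ (sub0set _); rewrite set0U setUC setUCr.
have := wired_bound k mu1_prob mu1_inv mu1_supp fi.
have := free_bound k mu0_prob mu0_inv mu0_supp fi.
by rewrite /gap; lra.
Qed.

Hypothesis a_gt0 : 0 < a.

Lemma contraction_lt1 : 0 <= 1 - (a / 2) ^+ #|B| < 1.
Proof.
have a2 : 0 < a / 2 by rewrite divr_gt0.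
rewrite gtrBl exprn_gt0// subr_ge0 exprn_ile1 ?ltW// ltr_pdivrMr// mul1r.
have [e _] : exists e : E, e \in predT by apply/card_gt0P.
have /andP[_ oe] := o01 set0 e; have ae := a_le set0 e; lra.
Qed.

(** Run the full dynamics from equilibrium and the wired one from the all-open
    configuration: the latter stays above and converges to [mu1]. The edges
    outside of [B] are open in the latter, so adding them to the former does not
    break this order. *)
Lemma stationary_le_wired g : increasing g ->
  mean pi (fun w => g (w :|: ~: B)) <= mean mu1 g.
Proof.
move=> gi; pose G w := g (w :|: ~: B).
have Gi : increasing G by move=> w w' ww'; apply: gi; exact: setSU.
have muG : mean mu1 G = mean mu1 g.
  apply: eq_bigr => w _; have [->|/mu1_supp Bw] := eqVneq (mu1 w) 0.
    by rewrite !mul0r.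
  by rewrite /G (setUidPl Bw).
rewrite -/G -muG; apply: (le_add_geometric contraction_lt1 (c := G [set: E] - G (~: B))) => j.
have := wired_bound (j * (#|B| * #|E|)) mu1_prob mu1_inv mu1_supp Gi.
have := stepn_contract_iter j (leqnn _) Gi (subxx (~: B)).
rewrite [~: B :|: B]setUC setUCr.
have := law_setT_dominates (j * (#|B| * #|E|)) Gi; rewrite -stepnE.
by rewrite [_ * _ ^+ j]mulrC; lra.
Qed.

Lemma free_le_stationary g : increasing g ->
  mean mu0 g <= mean pi (fun w => g (w :&: B)).
Proof.
move=> gi; pose G w := g (w :&: B).
have Gi : increasing G by move=> w w' ww'; apply: gi; exact: setSI.
have muG : mean mu0 G = mean mu0 g.
  apply: eq_bigr => w _; have [->|/mu0_supp Bw] := eqVneq (mu0 w) 0.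
    by rewrite !mul0r.
  by rewrite /G (setIidPl Bw).
rewrite -/G -muG; apply: (le_add_geometric contraction_lt1 (c := G B - G set0)) => j.
have := free_bound (j * (#|B| * #|E|)) mu0_prob mu0_inv mu0_supp Gi.
have := stepn_contract_iter j (leqnn _) Gi (sub0set (~: B)); rewrite set0U.
have := dominates_law_set0 (j * (#|B| * #|E|)) Gi; rewrite -stepnE.
by rewrite [_ * _ ^+ j]mulrC; lra.
Qed.

(** Two configurations that differ in [B] differ there by at least one edge,
    against which the whole range of values [u - l] is charged. *)
Lemma clip_lipschitz (G : {set E} -> R) l u :
  (forall w w', w :&: B = w' :&: B -> G w = G w') ->
  (forall w, l <= G w <= u) -> forall w w', w \subset w' ->
  `|G w' - G w| <= (u - l) * (#|w' :&: B|%:R - #|w :&: B|%:R).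
Proof.
move=> GB Glu w w' ww'; have wB : w :&: B \subset w' :&: B by exact: setSI.
have := subset_leq_card wB; rewrite leq_eqVlt => /orP[/eqP c12|c12].
  rewrite (GB w' w) ?subrr ?normr0 ?c12 ?subrr ?mulr0//.
  by apply/esym/eqP; rewrite eqEcard wB c12 /=.
have c1 : 1 <= #|w' :&: B|%:R - #|w :&: B|%:R :> R.
  by rewrite -natrB ?ler1n ?subn_gt0// ltnW.
have := Glu w; have := Glu w' => /andP[? ?] /andP[? ?].
apply: (@le_trans _ _ (u - l)); first by rewrite ler_norml; lra.
by rewrite ler_peMr//; lra.
Qed.

(** At time [s] the extreme chains both agree with a stationary configuration
    [w] in [B], or they differ there. In the second case the discrepancy after
    [t] more steps is at most [gap t e], and summing over the location gives the
    product. In the first case it is at most the discrepancy at time [t] of the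
    wired and free dynamics in [B], both started from [w]; since the law of [w]
    lies between their equilibria [mu0] and [mu1], the wired dynamics is still
    below [mu1], and the free one above [mu0], at time [t]. *)
Lemma gap_add s t e (rs rt : R) :
  (forall e', gap s e' <= rs) -> gap t e <= rt ->
  gap (s + t) e <= #|B|%:R * rs * rt
    + (mean mu1 (opened R e) - mean mu0 (opened R e)).
Proof.
move=> Hs Ht; have fi := @increasing_opened R E e.
pose F := stepn [set: E] t (opened R e); pose Q := stepn B t (opened R e).
have Fi : increasing F by exact: stepn_incr.
have Qi : increasing Q by exact: stepn_incr.
have F01 w : F set0 <= F w <= F [set: E] by rewrite !Fi ?sub0set ?subsetT.
(* [G1] and [G0] are clipped to the range of [F]: the discrepancy in [B] at time
   [s] is then multiplied by [gap t e], which is the width of this range. *)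
pose G1 w := Num.min (Q (w :|: ~: B)) (F [set: E]).
pose G0 w := Num.max (Q (w :&: B)) (F set0).
have FG1 w : F w <= G1 w.
  by rewrite le_min (andP (F01 w)).2 andbT; exact: stepn_le_wired.
have FG0 w : G0 w <= F w.
  by rewrite ge_max (andP (F01 w)).1 andbT; exact: stepn_ge_free.
have L1 := @clip_lipschitz G1 (F set0) (F [set: E]).
have L0 := @clip_lipschitz G0 (F set0) (F [set: E]).
have := mean_lipschitz (law_setT_dominates s) (L1 _ _).
have := mean_lipschitz (dominates_law_set0 s) (L0 _ _).
rewrite -/(gap t e) => {L1 L0} L0 L1.
have {}L1 := L1 _ _; have {}L0 := L0 _ _.
have {L1} : `|mean (law [set: E] s [set: E]) G1 - mean pi G1| <= gap t e *
    \sum_(e' in B) (mean (law [set: E] s [set: E]) (opened R e') - mean pi (opened R e')).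
  apply: L1 => [w w' ww'|w].
    rewrite /G1; congr (Num.min (Q _) _); apply/setP => x.
    by move/setP/(_ x): ww'; rewrite !inE; case: (x \in B); rewrite ?andbT ?orbF ?orbT.
  by rewrite (le_trans _ (FG1 w)) ?(andP (F01 w)).1//= ge_min lexx orbT.
have {L0} : `|mean pi G0 - mean (law [set: E] s set0) G0| <= gap t e *
    \sum_(e' in B) (mean pi (opened R e') - mean (law [set: E] s set0) (opened R e')).
  apply: L0 => [w w' ww'|w]; first by rewrite /G0 ww'.
  by rewrite (le_trans (FG0 w)) ?(andP (F01 w)).2// le_max lexx orbT.
rewrite !ler_norml => /andP[_ H0] /andP[_ H1].
have : stepn [set: E] (s + t) (opened R e) [set: E] <= mean (law [set: E] s [set: E]) G1.
  by rewrite stepnD stepnE; apply: ler_mean => // *; exact: is_prob_law.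
have : mean (law [set: E] s set0) G0 <= stepn [set: E] (s + t) (opened R e) set0.
  by rewrite stepnD stepnE; apply: ler_mean => // *; exact: is_prob_law.
have : mean pi G1 <= mean mu1 (opened R e).
  rewrite -(invariant_stepn t (opened R e) mu1_inv).
  apply: le_trans (stationary_le_wired Qi); apply: ler_mean => // w _.
  by rewrite ge_min lexx.
have : mean mu0 (opened R e) <= mean pi G0.
  rewrite -(invariant_stepn t (opened R e) mu0_inv).
  apply: le_trans (free_le_stationary Qi) _; apply: ler_mean => // w _.
  by rewrite le_max lexx.
have : gap t e * (\sum_(e' in B) (mean (law [set: E] s [set: E]) (opened R e')
      - mean pi (opened R e')) + \sum_(e' in B) (mean pi (opened R e') -
      mean (law [set: E] s set0) (opened R e'))) <= #|B|%:R * rs * rt.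
  rewrite -big_split/= (eq_bigr (gap s)) => [|e' _]; last first.
    by rewrite /gap 2!stepnE addrA subrK.
  rewrite mulrC; apply: ler_pM => //; first by rewrite sumr_ge0// => *; exact: gap_ge0.
    exact: gap_ge0.
  by rewrite mulr_natl -sumr_const; apply: ler_sum.
rewrite mulrDr [gap (s + t) e]/gap; lra.
Qed.

End Recursion.
End Stationary.

End Coalescence.
End MonotoneDynamics.

(** * Adding an edge to a graph *)

Section AddEdge.
Variable T : finType.
Implicit Types (r : rel T) (x y z : T).

Lemma connect_ind r (Q : T -> Prop) x y :
  (forall z z', Q z -> r z z' -> Q z') -> Q x -> connect r x y -> Q y.
Proof.
move=> Qr Qx /connectP[s]; elim: s x Qx => [|z s IH] x Qx /=; first by move=> _ ->.
by move=> /andP[xz zs]; apply: IH => //; exact: Qr xz.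
Qed.

(** The new edge merges the component of [u] with that of [v]. The roots outside of
    these two components are not affected, and the closure of [{u, v}] has one or
    two components before the edge is added, one afterwards. *)
Lemma n_comp_add_edge r r' (u v : T) (W : {set T}) :
  connect_sym r -> connect_sym r' ->
  (forall x y, r' x y = r x y || ((x == u) && (y == v)) || ((x == v) && (y == u))) ->
  (forall x y, x \in W -> r' x y -> y \in W) -> u \in W -> v \in W ->
  n_comp r W = (n_comp r' W + ~~ connect r u v)%N.
Proof.
move=> symr symr' r'E clW uW vW.
have rr' : subrel (connect r) (connect r').
  by apply: connect_sub => x y xy; rewrite connect1// r'E xy.
have uv' : connect r' u v by rewrite connect1// r'E !eqxx orbT.
case: (boolP (connect r u v)) => uv /=.
  rewrite addn0; apply: eq_n_comp => x y; apply/idP/idP => [/rr'//|].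
  apply: connect_sub => {}x {}y; rewrite r'E => /orP[/orP[/connect1//|]|].
    by move=> /andP[/eqP-> /eqP->].
  by move=> /andP[/eqP-> /eqP->]; rewrite symr.
pose A := closure r (pred2 u v).
have AE x : (x \in A) = connect r' u x.
  apply/idP/idP.
    case/existsP => y /andP[/= xy /pred2P yuv]; rewrite symr'.
    apply: connect_trans (rr' _ _ xy) _.
    by case: yuv => ->; rewrite ?connect0// symr'.
  apply: (@connect_ind r' (fun x => x \in A)).
    move=> y z yA; rewrite r'E => /orP[/orP[yz|]|].
    - by rewrite -(closure_closed symr (pred2 u v) yz).
    - by move=> /andP[_ /eqP->]; apply: mem_closure; rewrite inE eqxx orbT.
    - by move=> /andP[_ /eqP->]; apply: mem_closure; rewrite inE eqxx.
  by apply: mem_closure; rewrite inE eqxx.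
have out x y : x \notin A -> connect r' x y = connect r x y.
  move=> xA; apply/idP/idP => [|/rr'//].
  move=> xy; have [] : connect r x y /\ y \notin A; last by [].
  move: xy; apply: (@connect_ind r' (fun y => connect r x y /\ y \notin A)); last first.
    by rewrite connect0.
  move=> z z' [xz zA] zz'; have rzz' : r z z'.
    move: zz'; rewrite r'E => /orP[/orP[//|]|] /andP[/eqP zu _];
      by rewrite zu mem_closure ?inE ?eqxx ?orbT in zA.
  split; first exact: connect_trans xz (connect1 rzz').
  by rewrite -(closure_closed symr (pred2 u v) rzz').
have AW x : x \in A -> x \in W.
  by rewrite AE; apply: (@connect_ind r' (fun x => x \in W)) => //.
have split2 r0 : n_comp r0 W = (n_comp r0 A + #|[predI roots r0 & [predD W & A]]|)%N.
  rewrite /n_comp_mem -(cardID A (predI (roots r0) _)); congr (_ + _)%N.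
    apply: eq_card => x; rewrite !inE -andbA; congr (_ && _).
    by case: (boolP (x \in A)) => xA; rewrite ?andbF// AW.
  by apply: eq_card => x; rewrite !inE andbCA.
rewrite !split2 [n_comp r A]n_comp_closure2// (negbTE uv) /=.
have -> : n_comp r' A = 1%N.
  by rewrite -(n_comp_connect symr' u); apply: eq_n_comp_r.
rewrite (eq_card (B := [predI roots r' & [predD W & A]])).
  by rewrite addnAC.
move=> x; rewrite !inE; case: (boolP (x \in A)) => xA; rewrite ?andbF//= /roots /root.
by rewrite (eq_pick (fun y => out x y xA)).
Qed.

End AddEdge.

(** * Wired graphs *)

Section Wired.
Variables (V E : finType) (ends : E -> {set V}).
Hypothesis endsP : forall e, exists u v, ends e = [set u; v].
Implicit Types (xi : {set {set V}}) (w F eta : {set E}) (W : {set V}).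

Local Notation adj := (wired_adj ends).

Lemma wired_adj_sym w xi : trivIset xi -> symmetric (adj w xi).
Proof.
move=> txi; suff H u v : adj w xi u v -> adj w xi v u.
  by move=> u v; apply/idP/idP; exact: H.
move=> /orP[/existsP[e /andP[ew ee]]|uv]; apply/orP.
  by left; apply/existsP; exists e; rewrite ew setUC.
right; move: uv; rewrite {1}/pblock; case: pickP => [A /andP[AP uA] vA|_].
  by rewrite (def_pblock txi AP vA).
by rewrite inE.
Qed.

Lemma connect_wired_sym w xi : trivIset xi -> connect_sym (adj w xi).
Proof. by move=> /wired_adj_sym txi; exact: sym_connect_sym. Qed.

Lemma wired_adj_sub w w' xi : w \subset w' -> subrel (adj w xi) (adj w' xi).
Proof.
move=> ww' x y /orP[/existsP[e /andP[ew ee]]|xy]; apply/orP; last by right.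
by left; apply/existsP; exists e; rewrite (subsetP ww').
Qed.

Lemma connect_wired_sub w w' xi x y : w \subset w' ->
  connect (adj w xi) x y -> connect (adj w' xi) x y.
Proof.
move=> ww'; apply: connect_sub => {}x {}y xy.
exact: connect1 (wired_adj_sub ww' xy).
Qed.

Lemma wired_adj_add w xi e u v x y : ends e = [set u; v] ->
  adj (e |: w) xi x y =
    adj w xi x y || ((x == u) && (y == v)) || ((x == v) && (y == u)).
Proof.
move=> eE; apply/idP/idP.
  move=> /orP[/existsP[f /andP[fw ff]]|xy]; last by rewrite /wired_adj xy orbT.
  move: fw; rewrite !inE => /orP[/eqP fe|fw]; last first.
    by rewrite /wired_adj; apply/orP; left; apply/orP; left; apply/orP; left;
      apply/existsP; exists f; rewrite fw.
  move: ff; rewrite fe eE => /eqP/setP H.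
  have := H x; have := H y; have := H u; have := H v.
  rewrite !inE !eqxx !orbT/= => /esym hv /esym hu hy hx.
  case/orP: hx hu hv => /eqP->; case/orP: hy => /eqP->; rewrite !eqxx ?orbT//=.
    by move=> _ /orP[]/eqP->; rewrite !eqxx ?orbT.
  by move=> /orP[]/eqP->; rewrite !eqxx ?orbT.
move=> /orP[/orP[|]|].
- exact/wired_adj_sub/subsetUr.
- move=> /andP[/eqP-> /eqP->]; apply/orP; left; apply/existsP; exists e.
  by rewrite !inE eqxx eE/=.
- move=> /andP[/eqP-> /eqP->]; apply/orP; left; apply/existsP; exists e.
  by rewrite !inE eqxx eE setUC/=.
Qed.

Lemma ncomp_add_edge W w xi e u v : trivIset xi -> ends e = [set u; v] ->
  (forall x y, x \in W -> adj (e |: w) xi x y -> y \in W) ->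
  u \in W -> v \in W ->
  ncomp ends W w xi = (ncomp ends W (e |: w) xi + ~~ connect (adj w xi) u v)%N.
Proof.
move=> txi eE clW uW vW; apply: n_comp_add_edge => //.
- exact: connect_wired_sym.
- exact: connect_wired_sym.
- by move=> x y; exact: wired_adj_add.
Qed.

Section Induced.
Variables (xi : {set {set V}}) (W : {set V}) (F eta : {set E}).
Hypothesis txi : trivIset xi.
Hypothesis FW : forall e, e \in F -> ends e \subset W.

Local Notation bc := (induced_bc ends W eta xi).

Lemma connect_wired_equivalence :
  {in W & &, equivalence_rel (connect (adj eta xi))}.
Proof.
move=> x y z _ _ _; split; first exact: connect0.
by move=> xy; apply: same_connect => //; exact: connect_wired_sym.
Qed.

Lemma induced_partition : partition bc W.
Proof. exact/equivalence_partitionP/connect_wired_equivalence. Qed.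

Lemma induced_trivIset : trivIset bc.
Proof. by have /and3P[] := induced_partition. Qed.

Lemma mem_induced x y : y \in pblock bc x -> [/\ x \in W, y \in W & connect (adj eta xi) x y].
Proof.
move=> xy; have xW : x \in W.
  rewrite -(cover_partition induced_partition).
  move: xy; rewrite /pblock; case: pickP => [A /andP[AP xA] _|]; last by rewrite inE.
  by apply/bigcupP; exists A.
have yW : y \in W.
  rewrite -(cover_partition induced_partition) -mem_pblock.
  by rewrite (same_pblock induced_trivIset xy).
split=> //.
by rewrite -(pblock_equivalence_partition connect_wired_equivalence xW yW).
Qed.

Lemma induced_closed w x y : w \subset F ->
  x \in W -> adj w bc x y -> y \in W.
Proof.
move=> wF xW /orP[/existsP[e /andP[ew /eqP ee]]|/mem_induced[]//].
apply: (subsetP (FW (subsetP wF _ ew))); rewrite ee !inE eqxx orbT //.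
Qed.

(** A path of the whole graph between two vertices of [W] alternates between edges
    of [w] and excursions through [eta] and [xi]; the ends of an excursion lie in
    [W], hence in the same block of the induced boundary condition. *)
Lemma connect_induced w u v : w \subset F -> u \in W -> v \in W ->
  connect (adj w bc) u v = connect (adj (w :|: eta) xi) u v.
Proof.
move=> wF uW vW; apply/idP/idP.
  apply: connect_sub => x y /orP[|/mem_induced[_ _]].
    move=> H; apply: connect1; apply/orP; left.
    move: H => /existsP[e /andP[ew ee]]; apply/existsP; exists e.
    by rewrite inE ew.
  exact/connect_wired_sub/subsetUr.
move=> uv.
pose Q z := exists x, [/\ x \in W, connect (adj w bc) u x & connect (adj eta xi) x z].
have Qstep x z : x \in W -> z \in W -> connect (adj eta xi) x z ->
    connect (adj w bc) x z.
  move=> xW zW xz; apply/connect1/orP; right.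
  by rewrite (pblock_equivalence_partition connect_wired_equivalence xW zW).
suff [x [xW ux xv]] : Q v by exact: connect_trans ux (Qstep _ _ xW vW xv).
apply: connect_ind uv; last by exists u; rewrite !connect0.
move=> z z' [x [xW ux xz]] /orP[/existsP[e /andP[]]|zz']; last first.
  exists x; split=> //; apply: connect_trans xz (connect1 _).
  by apply/orP; right.
rewrite inE => /orP[ew|ee] /eqP eE; last first.
  exists x; split=> //; apply: connect_trans xz (connect1 _).
  by apply/orP; left; apply/existsP; exists e; rewrite ee eE/=.
have /subsetP eW := FW (subsetP wF _ ew).
have zW : z \in W by apply: eW; rewrite eE !inE eqxx.
have z'W : z' \in W by apply: eW; rewrite eE !inE eqxx orbT.
exists z'; split; rewrite ?connect0//.
apply: connect_trans ux (connect_trans (Qstep _ _ xW zW xz) (connect1 _)).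
by apply/orP; left; apply/existsP; exists e; rewrite ew eE/=.
Qed.

(** Both drops say whether the ends of [e] are already connected, and
    [connect_induced] makes this the same question in the two graphs. *)
Lemma ncomp_induced_drop w e : w \subset F -> e \in F -> exists b : bool,
  ncomp ends W w bc = (ncomp ends W (e |: w) bc + b)%N /\
  ncomp ends [set: V] (w :|: eta) xi =
    (ncomp ends [set: V] (e |: (w :|: eta)) xi + b)%N.
Proof.
move=> wF eF; have [u [v eE]] := endsP e.
have := FW eF; rewrite eE subUset !sub1set => /andP[uW vW].
exists (~~ connect (adj (w :|: eta) xi) u v); split; last first.
  by apply: ncomp_add_edge => //; rewrite inE.
rewrite -connect_induced//; apply: ncomp_add_edge => //.
  exact: induced_trivIset.
by move=> x y; apply: induced_closed; rewrite subUset sub1set eF.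
Qed.

End Induced.

(** * The heat-bath rule of the random-cluster model *)

Section HeatBath.
Variables (R : realType) (p q : R) (xi : {set {set V}}).
Hypotheses (p01 : 0 <= p <= 1) (q1 : 1 <= q) (txi : trivIset xi).

Local Notation bridge_prob := (p / (q * (1 - p) + p)).
Local Notation o := (open_prob ends p q xi).

Lemma bridge_den_gt0 : 0 < q * (1 - p) + p.
Proof.
have /andP[p0 p1] := p01.
have : 0 <= (q - 1) * (1 - p) by rewrite mulr_ge0 ?subr_ge0.
by nra.
Qed.

Lemma bridge_prob_ge0 : 0 <= bridge_prob.
Proof. by have /andP[p0 _] := p01; rewrite divr_ge0// ltW// bridge_den_gt0. Qed.

Lemma bridge_prob_le : bridge_prob <= p.
Proof.
rewrite ler_pdivrMr ?bridge_den_gt0//; have /andP[p0 p1] := p01.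
have : 0 <= p * ((q - 1) * (1 - p)) by rewrite !mulr_ge0 ?subr_ge0.
by nra.
Qed.

Lemma open_probE w e u v : ends e = [set u; v] ->
  o w e = if connect (adj (w :\ e) xi) u v then p else bridge_prob.
Proof.
move=> eE; rewrite /open_prob (ncomp_add_edge (W := [set: V]) txi eE) ?inE//.
have -> : e |: w :\ e = e |: w.
  by apply/setP => x; rewrite !inE; case: (x == e).
by case: connect => /=; rewrite ?addn0 ?eqxx// addn1 eqn_leq ltnn/=.
Qed.

Lemma open_prob01 w e : 0 <= o w e <= 1.
Proof.
have /andP[p0 p1] := p01.
rewrite /open_prob; case: ifP => _; last by rewrite p0.
by rewrite bridge_prob_ge0 (le_trans bridge_prob_le).
Qed.

Lemma open_prob_ge w e : bridge_prob <= o w e.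
Proof. by rewrite /open_prob; case: ifP => _ //; exact: bridge_prob_le. Qed.

Lemma open_prob_incr w w' e : w \subset w' -> o w e <= o w' e.
Proof.
move=> ww'; have [u [v eE]] := endsP e; rewrite !(open_probE _ eE).
case: ifP => [uv|_]; last by case: ifP => _ //; exact: bridge_prob_le.
by rewrite (connect_wired_sub (setSD _ ww') uv).
Qed.

Lemma edge_updateE e (g : {set E} -> R) w :
  \sum_w' edge_update ends p q xi e w w' * g w' = upd o e g w.
Proof.
rewrite /edge_update /upd.
under eq_bigr => w' _ do rewrite mulrDl -!mulrA.
rewrite big_split/= -!mulr_sumr; congr (_ * _ + _ * _).
  rewrite (bigD1 (e |: w))//= eqxx mul1r big1 ?addr0// => y /negbTE->.
  by rewrite mul0r.
rewrite (bigD1 (w :\ e))//= eqxx mul1r big1 ?addr0// => y /negbTE->.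
by rewrite mul0r.
Qed.

Lemma fk_stepE (g : {set E} -> R) w :
  \sum_w' fk_step ends p q xi w w' * g w' = step o [set: E] g w.
Proof.
rewrite /fk_step /step.
under eq_bigr => w' _ do rewrite -mulrA mulr_suml.
rewrite -mulr_sumr exchange_big/=; congr (_ * _); apply: eq_bigr => e _.
by rewrite inE edge_updateE.
Qed.

Section Measures.
Variables (W : {set V}) (F : {set E}) (bc : {set {set V}}).
Local Notation weight := (rc_weight ends p q W F bc).
Local Notation mu := (rc_measure ends p q W F bc).

Lemma rc_weight_ge0 w : 0 <= weight w.
Proof.
have /andP[p0 p1] := p01.
by rewrite !mulr_ge0 ?exprn_ge0 ?subr_ge0// (le_trans ler01).
Qed.

Lemma rc_partition_gt0 : 0 < \sum_(w : {set E} | w \subset F) weight w.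
Proof.
have /andP[p0 p1] := p01; have q0 : 0 < q by exact: lt_le_trans q1.
have [w wF w_gt0] : exists2 w : {set E}, w \subset F & 0 < weight w.
  have [->|p_neq1] := eqVneq p 1.
    exists F => //; rewrite /rc_weight subnn expr0 expr1n mulr1 mul1r.
    exact: exprn_gt0.
  exists set0; rewrite ?sub0set// /rc_weight cards0 expr0 mul1r.
  by rewrite mulr_gt0 ?exprn_gt0// subr_gt0 lt_neqAle p_neq1.
rewrite (bigD1 w)//= ltr_pwDl// sumr_ge0// => *; exact: rc_weight_ge0.
Qed.

Lemma is_prob_rc_measure : is_prob mu.
Proof.
have Z0 := rc_partition_gt0; split=> [w|].
  by rewrite /rc_measure; case: ifP => // _; rewrite divr_ge0 ?rc_weight_ge0 ?ltW.
by rewrite /rc_measure -big_mkcond/= -mulr_suml divff ?gt_eqF.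
Qed.

Lemma rc_measure_out w : ~~ (w \subset F) -> mu w = 0.
Proof. by rewrite /rc_measure => /negbTE->. Qed.

(** Detailed balance: an edge that merges two components divides the weight by
    [q] in addition to the factor [p / (1 - p)], for which [bridge_prob]
    compensates. *)
Lemma rc_measure_balance w e (b : bool) : e \in F -> e \notin w ->
  ncomp ends W w bc = (ncomp ends W (e |: w) bc + b)%N ->
  mu (e |: w) * (1 - (if b then bridge_prob else p)) =
  mu w * (if b then bridge_prob else p).
Proof.
move=> eF ew nE; rewrite /rc_measure subUset sub1set eF/=.
case: ifP => wF; last by rewrite !mul0r.
rewrite [LHS]mulrAC [RHS]mulrAC; congr (_ / _).
rewrite /rc_weight nE cardsU1 ew add1n.
have wF' : (#|w| < #|F|)%N.
  apply: proper_card; rewrite properE wF/=.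
  by apply/negP => /subsetP/(_ _ eF); rewrite (negbTE ew).
have -> : (#|F| - #|w| = (#|F| - #|w|.+1).+1)%N by rewrite subnSK.
rewrite exprD !exprS.
have d0 : q * (1 - p) + p != 0 by rewrite gt_eqF// bridge_den_gt0.
move: (p ^+ _) ((1 - p) ^+ _) (q ^+ ncomp _ _ _ _) => x y z.
case: b {nE} => /=; rewrite ?expr1 ?expr0; last by ring.
by field.
Qed.

End Measures.

(** The image of [mu] under the union with [eta]: the model in a subgraph, seen
    as a law on the configurations of the whole graph. *)
Definition extend (mu : {set E} -> R) eta w : R :=
  \sum_w' mu w' * (w == w' :|: eta)%:R.

Lemma mean_extend mu eta (g : {set E} -> R) :
  mean (extend mu eta) g = \sum_w mu w * g (w :|: eta).
Proof.
rewrite /mean /extend; under eq_bigr => w _ do rewrite mulr_suml.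
rewrite exchange_big/=; apply: eq_bigr => w _.
rewrite (bigD1 (w :|: eta))//= eqxx mulr1 big1 ?addr0// => y /negbTE->.
by rewrite mulr0 mul0r.
Qed.

Lemma is_prob_extend mu eta : is_prob mu -> is_prob (extend mu eta).
Proof.
move=> [mu0 mu1]; split=> [w|].
  by rewrite sumr_ge0// => w' _; rewrite mulr_ge0.
have := mean_extend mu eta (fun=> 1); rewrite /mean.
under eq_bigr => w _ do rewrite mulr1.
by move=> ->; rewrite -mulr_suml mu1 mul1r.
Qed.

Lemma extend_supp mu eta w : extend mu eta w != 0 ->
  exists2 w', mu w' != 0 & w = w' :|: eta.
Proof.
move=> w0; have /existsP[w' /andP[m0 /eqP->]] :
    [exists w', (mu w' != 0) && (w == w' :|: eta)].
  apply: contraNT w0 => /existsPn H; rewrite /extend big1// => w' _.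
  by have := H w'; rewrite negb_and negbK => /orP[/eqP->|/negbTE->];
    rewrite ?mul0r ?mulr0.
by exists w'.
Qed.

Lemma sum_split_edge e (h : {set E} -> R) :
  \sum_w h w = \sum_(w : {set E} | e \notin w) (h w + h (e |: w)).
Proof.
rewrite (bigID (fun w : {set E} => e \in w))/= addrC big_split/=; congr (_ + _).
rewrite (reindex_onto (fun w => e |: w) (fun w => w :\ e)) /=; last first.
  by move=> w ew; rewrite setD1K.
apply: eq_bigl => w; rewrite setU11/=; apply/eqP/idP => [<-|ew].
  by rewrite !inE eqxx.
by rewrite setU1K.
Qed.

(** The random-cluster measure on a subgraph, with the boundary condition
    induced by [eta], is reversible for the updates of the whole graph at the
    edges of the subgraph when the other edges are kept as in [eta]. *)
Lemma invariant_extend W F eta : (forall e, e \in F -> ends e \subset W) ->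
  (forall e, e \in F -> e \notin eta) -> (0 < #|E|)%N ->
  step_invariant o F (extend (rc_measure ends p q W F (induced_bc ends W eta xi)) eta).
Proof.
move=> FW Feta E0 g; set mu := rc_measure _ _ _ _ _ _.
have main e : e \in F -> \sum_w mu w * upd o e g (w :|: eta) =
    \sum_w mu w * g (w :|: eta).
  move=> eF; rewrite !(sum_split_edge e); apply: eq_bigr => w ew.
  case: (boolP (w \subset F)) => wF; last first.
    have out w' : ~~ (w' \subset F) -> mu w' = 0 by exact: rc_measure_out.
    by rewrite !out ?subUset ?(negbTE wF) ?andbF// !mul0r.
  have eweta : e \notin w :|: eta by rewrite inE negb_or ew Feta.
  have [b [b1 b2]] := ncomp_induced_drop eta txi FW wF eF.
  have oE w' : (w' == w :|: eta) || (w' == e |: (w :|: eta)) ->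
      o w' e = if b then bridge_prob else p.
    rewrite /open_prob => w'E.
    have -> : w' :\ e = w :|: eta.
      by case/orP: w'E => /eqP->; rewrite ?setU1K//; apply/setDidPl;
        rewrite disjoint_sym disjoints1.
    have -> : e |: w' = e |: (w :|: eta).
      by case/orP: w'E => /eqP->; rewrite // setUA setUid.
    by rewrite b2; case: (b); rewrite ?addn0 ?eqxx// addn1 eqn_leq ltnn.
  have := rc_measure_balance eF ew b1; rewrite -/mu.
  rewrite /upd -!setUA !oE ?eqxx ?orbT// setU1K// [e |: (e |: _)]setUA setUid.
  have -> : (w :|: eta) :\ e = w :|: eta.
    by apply/setDidPl; rewrite disjoint_sym disjoints1.
  move: (mu (e |: w)) (mu w) (g _) (g _) (if b then _ else _) => m1 m0 g0 g1 c H.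
  apply/eqP; rewrite -subr_eq0; apply/eqP.
  transitivity ((m0 * c - m1 * (1 - c)) * (g1 - g0)); first by ring.
  by rewrite H subrr mul0r.
rewrite !mean_extend /step.
under eq_bigr => w _ do rewrite mulrCA mulr_sumr.
rewrite -mulr_sumr exchange_big/=.
rewrite (eq_bigr (fun=> \sum_w mu w * g (w :|: eta))) ?sum_NE// => e _.
by case: (boolP (e \in F)) => // eF; exact: main.
Qed.

End HeatBath.
End Wired.

(** * Poissonization *)

Section CauchyProduct.
Variable R : realType.
Implicit Types (a b u v : nat -> R) (c : R).

Lemma sum_antidiagonals (F : nat -> nat -> R) n :
  \sum_(0 <= k < n) \sum_(0 <= i < k.+1) F i (k - i)%N =
  \sum_(0 <= i < n) \sum_(0 <= j < n - i) F i j.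
Proof.
elim: n => [|n IH]; first by rewrite !big_geq.
rewrite big_nat_recr//= IH [RHS]big_nat_recr//= subSnn big_nat1.
rewrite [X in _ + X]big_nat_recr//= subnn addrA; congr (_ + _).
rewrite -big_split/= big_nat [RHS]big_nat.
by apply: eq_bigr => i /= ni; rewrite subSn 1?ltnW// big_nat_recr.
Qed.

(** The triangular partial sums of a Cauchy product differ from the square ones
    by at most what they do for the two series of absolute values. *)
Lemma cauchy_product_le a b a' b' n :
  (forall i, `|a i| <= a' i) -> (forall i, `|b i| <= b' i) ->
  `|series a n * series b n
    - \sum_(0 <= k < n) \sum_(0 <= i < k.+1) a i * b (k - i)%N| <=
  series a' n * series b' n
    - \sum_(0 <= k < n) \sum_(0 <= i < k.+1) a' i * b' (k - i)%N.
Proof.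
move=> aa bb.
have diffE (x y : nat -> R) : series x n * series y n
    - \sum_(0 <= k < n) \sum_(0 <= i < k.+1) x i * y (k - i)%N =
    \sum_(0 <= i < n) \sum_(n - i <= j < n) x i * y j.
  rewrite (sum_antidiagonals (fun i j => x i * y j)) /series/= mulr_suml -sumrB.
  apply: eq_bigr => i _; rewrite mulr_sumr.
  by rewrite (big_cat_nat (leq0n _) (leq_subr i n))/= addrAC subrr add0r.
rewrite !diffE; apply: le_trans (ler_norm_sum _ _ _) _; apply: ler_sum => i _.
apply: le_trans (ler_norm_sum _ _ _) _; apply: ler_sum => j _.
by rewrite normrM ler_pM.
Qed.

Lemma series_exp_le c n : 0 <= c -> series (exp_coeff c) n <= expR c.
Proof.
move=> c0; apply: nondecreasing_cvgn_le; last exact: is_cvg_series_exp_coeff.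
by apply: nondecreasing_series => i _ _; exact: exp_coeff_ge0.
Qed.

Lemma exp_coeff_add (x y : R) k :
  exp_coeff (x + y) k = \sum_(0 <= i < k.+1) exp_coeff x i * exp_coeff y (k - i)%N.
Proof.
rewrite /exp_coeff/= addrC exprDn mulr_suml big_mkord; apply: eq_bigr => i _.
rewrite -mulr_natl.
have ik : (i <= k)%N by rewrite -ltnS.
have := bin_fact ik => /(congr1 (fun n => n%:R : R)); rewrite !natrM => <-.
have fi : (i`!%:R : R) != 0 by rewrite pnatr_eq0 -lt0n fact_gt0.
have fk : ((k - i)`!%:R : R) != 0 by rewrite pnatr_eq0 -lt0n fact_gt0.
have bk : ('C(k, i)%:R : R) != 0 by rewrite pnatr_eq0 -lt0n bin_gt0.
by field; rewrite fi fk bk.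
Qed.

Lemma cvg_series_weighted c u : 0 <= c -> (forall i, `|u i| <= 1) ->
  cvgn (series (fun i => exp_coeff c i * u i)).
Proof.
move=> c0 u1; apply: normed_cvg.
apply: (@series_le_cvg _ _ (exp_coeff c)) => [n|n|n|].
- exact: normr_ge0.
- exact: exp_coeff_ge0.
- by rewrite /= normrM (ger0_norm (exp_coeff_ge0 _ _))// ler_piMr// exp_coeff_ge0.
- exact: is_cvg_series_exp_coeff.
Qed.

(** The Cauchy product with the exponential series at [- c]: by
    [cauchy_product_le], the error is at most [E_n(c) ^ 2 - E_n(2 c)], where [E_n]
    is the partial exponential sum, and this tends to [0]. *)
Lemma cvg_series_mul_expN c u : 0 <= c -> (forall i, `|u i| <= 1) ->
  ((fun n => \sum_(0 <= k < n) \sum_(0 <= i < k.+1)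
     (exp_coeff c i * u i) * exp_coeff (- c) (k - i)%N) @ \oo -->
   limn (series (fun i => exp_coeff c i * u i)) * expR (- c))%classic.
Proof.
move=> c0 u1.
pose b i := exp_coeff c i * u i.
pose S n := \sum_(0 <= k < n) \sum_(0 <= i < k.+1) b i * exp_coeff (- c) (k - i)%N.
pose D n := series b n * series (exp_coeff (- c)) n.
have cD : (D @ \oo --> limn (series b) * expR (- c))%classic.
  apply: cvgM; first exact: cvg_series_weighted.
  exact: is_cvg_series_exp_coeff.
pose T n := series (exp_coeff c) n * series (exp_coeff c) n - series (exp_coeff (c + c)) n.
have cT : (T @ \oo --> (0 : R))%classic.
  have <- : expR c * expR c - expR (c + c) = 0 by rewrite expRD subrr.
  by apply: cvgB; [apply: cvgM|]; exact: is_cvg_series_exp_coeff.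
have le n : `|D n - S n| <= T n.
  have -> : T n = series (exp_coeff c) n * series (exp_coeff c) n -
    \sum_(0 <= k < n) \sum_(0 <= i < k.+1) exp_coeff c i * exp_coeff c (k - i)%N.
    by rewrite /T; congr (_ - _); apply: eq_bigr => k _; exact: exp_coeff_add.
  apply: cauchy_product_le => i.
    by rewrite /b normrM (ger0_norm (exp_coeff_ge0 _ _))// ler_piMr// exp_coeff_ge0.
  by rewrite /exp_coeff/= normrM normrX normrN (ger0_norm c0) ger0_norm// invr_ge0.
have cDS : ((fun n => D n - S n) @ \oo --> (0 : R))%classic.
  apply: (@squeeze_cvgr _ _ _ _ (fun n => - T n) T) => //.
    by apply: nearW => n; rewrite -ler_norml.
  by rewrite -oppr0; exact: cvgN.
rewrite (_ : (fun n => _) = (fun n => D n - (D n - S n))).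
  by have H := cvgB cD cDS; rewrite subr0 in H; exact: H.
by apply/funext => n; rewrite opprB addrC subrK.
Qed.

(** The part below [k0] of the Poisson law of mean [c = 2 k0 + 6] has mass at most
    [1 / 8]. Since [2 <= e], each term of index below [k0] is at most [exp(k0)]
    times the term at [c / 2], and [k0 + c / 2 = c - 3]. *)
Lemma series_exp_head_le k0 n c : c = (2 * k0 + 6)%:R ->
  \sum_(0 <= k < n) exp_coeff c k * (k < k0)%:R <= expR c / 8.
Proof.
move=> cE; have e2 : 2 <= expR 1 :> R by apply: le_trans (expR_ge1Dx 1); lra.
have c0 : 0 <= c by rewrite cE ler0n.
apply: (@le_trans _ _ (expR k0%:R * series (exp_coeff (c / 2)) n)).
  rewrite /series/= mulr_sumr; apply: ler_sum => k _.
  case: ltnP => kk0; last first.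
    by rewrite mulr0 mulr_ge0 ?expR_ge0// exp_coeff_ge0// divr_ge0.
  rewrite mulr1 /exp_coeff/= mulrA ler_wpM2r// exprMn mulrCA ler_peMr ?exprn_ge0//.
  rewrite exprVn ler_pdivlMr ?exprn_gt0// mul1r -(mulr1 k0%:R) expRM_natl.
  apply: (@le_trans _ _ (expR 1 ^+ k)); first by rewrite lerXn2r// nnegrE ?expR_ge0.
  by apply: ler_weXn2l; [lra|exact: ltnW].
apply: (@le_trans _ _ (expR k0%:R * expR (c / 2))).
  by rewrite ler_wpM2l ?expR_ge0// series_exp_le// divr_ge0.
rewrite -expRD (_ : k0%:R + c / 2 = c - 3); last by rewrite cE natrD natrM; lra.
rewrite expRD ler_wpM2l ?expR_ge0// expRN lef_pV2 ?posrE ?expR_gt0//.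
have -> : 3 = 3%:R * 1 :> R by rewrite mulr1.
rewrite expRM_natl (_ : 8 = 2 ^+ 3); last by rewrite !exprS expr0; lra.
by rewrite lerXn2r// nnegrE ?expR_ge0.
Qed.

Lemma poisson_average_le k0 (v : nat -> R) c : c = (2 * k0 + 6)%:R ->
  (forall k, `|v k| <= 1) -> (forall k, (k0 <= k)%N -> `|v k| <= 8^-1) ->
  `|limn (series (fun k => exp_coeff c k * v k)) * expR (- c)| <= 4^-1.
Proof.
move=> cE v1 v8; have c0 : 0 <= c by rewrite cE ler0n.
have cv := cvg_series_weighted c0 v1.
have bound n : `|series (fun k => exp_coeff c k * v k) n| <= expR c / 4.
  apply: le_trans (ler_norm_sum _ _ _) _.
  apply: (@le_trans _ _ (\sum_(0 <= k < n) exp_coeff c k * (k < k0)%:R +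
      series (exp_coeff c) n / 8)).
    rewrite /series/= mulr_suml -big_split/=; apply: ler_sum => k _.
    have e0 := exp_coeff_ge0 k c0.
    rewrite normrM (ger0_norm e0) -mulrDr ler_wpM2l//.
    case: ltnP => [_|/v8]; last by rewrite add0r.
    by apply: le_trans (v1 k) _; rewrite mulr1n lerDl invr_ge0.
  have := series_exp_head_le n cE; have := series_exp_le n c0; lra.
rewrite normrM (ger0_norm (expR_ge0 _)) expRN ler_pdivrMr ?expR_gt0// mulrC.
rewrite ler_norml; apply/andP; split.
  by apply: limr_ge => //; apply: nearW => n; have := bound n; rewrite ler_norml => /andP[].
by apply: limr_le => //; apply: nearW => n; have := bound n; rewrite ler_norml => /andP[].
Qed.

End CauchyProduct.

Section KernelPowers.
Variables (R : realType) (T : finType).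
Implicit Types (K : T -> T -> R).

Lemma kernel_pow0 K x y : kernel_pow K 0 x y = (x == y)%:R.
Proof.
by rewrite /kernel_pow expr0 mxE (inj_eq enum_rank_inj).
Qed.

Lemma kernel_powS K k x y :
  kernel_pow K k.+1 x y = \sum_z K x z * kernel_pow K k z y.
Proof.
rewrite /kernel_pow exprS mxE (reindex enum_rank)/=; last first.
  by apply: onW_bij; exact: enum_rank_bij.
by apply: eq_bigr => z _; rewrite mxE !enum_rankK.
Qed.

Lemma kernel_pow_scale K c k x y :
  kernel_pow (fun x y => c * K x y) k x y = c ^+ k * kernel_pow K k x y.
Proof.
elim: k x => [|k IH] x; first by rewrite !kernel_pow0 expr0 mul1r.
rewrite !kernel_powS exprS mulr_sumr; apply: eq_bigr => z _.
by rewrite IH; ring.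
Qed.

(** The binomial formula for [N (K - 1)]; the powers of [K] are kept as they are
    bounded, unlike those of [K - 1]. *)
Lemma kernel_pow_generator K N k x y :
  kernel_pow (fun x y => N * (K x y - (y == x)%:R)) k x y =
  N ^+ k * \sum_(0 <= i < k.+1) (-1) ^+ (k - i) * kernel_pow K i x y *+ 'C(k, i).
Proof.
rewrite (kernel_pow_scale (fun x y => K x y - (y == x)%:R)).
pose M := kernel_mx K.
rewrite {1}/kernel_pow (_ : kernel_mx _ = -1 + M); last first.
  apply/matrixP => i j.
  by rewrite !mxE (inj_eq enum_val_inj) eq_sym addrC.
rewrite exprDn_comm; last by rewrite /GRing.comm mulN1r mulrN1.
congr (_ * _); rewrite summxE big_mkord; apply: eq_bigr => i _.
rewrite mulmxnE; congr (_ *+ _).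
elim: (k - i)%N => [|m IH]; first by rewrite !expr0 !mul1r.
by rewrite !exprS -!mulrA !mulN1r mxE IH.
Qed.

(** Uniformization: the chain that jumps according to [K] at rate [N] has made a
    Poisson number of jumps at time [t]. *)
Lemma semigroup_poisson K N t x y :
  0 <= N * t -> (forall i, `|kernel_pow K i x y| <= 1) ->
  semigroup (fun x y => N * (K x y - (y == x)%:R)) t x y =
  limn (series (fun i => exp_coeff (N * t) i * kernel_pow K i x y)) * expR (- (N * t)).
Proof.
move=> c0 K1; apply/cvg_lim => //.
rewrite (_ : series _ = (fun n => \sum_(0 <= k < n) \sum_(0 <= i < k.+1)
  (exp_coeff (N * t) i * kernel_pow K i x y) * exp_coeff (- (N * t)) (k - i)%N)).
  exact: (cvg_series_mul_expN c0 K1).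
apply/funext => n; apply: eq_bigr => k _; rewrite kernel_pow_generator.
rewrite mulrA mulr_sumr [LHS]big_nat [RHS]big_nat; apply: eq_bigr => i /=.
rewrite ltnS => ik; rewrite /exp_coeff/= -mulr_natl.
have := bin_fact ik => /(congr1 (fun n => n%:R : R)); rewrite !natrM => <-.
have fi : (i`!%:R : R) != 0 by rewrite pnatr_eq0 -lt0n fact_gt0.
have fk : ((k - i)`!%:R : R) != 0 by rewrite pnatr_eq0 -lt0n fact_gt0.
have bk : ('C(k, i)%:R : R) != 0 by rewrite pnatr_eq0 -lt0n bin_gt0.
have E : t ^+ k * N ^+ k = (N * t) ^+ i * (N * t) ^+ (k - i).
  by rewrite -exprD subnKC// exprMn mulrC.
transitivity (t ^+ k * N ^+ k *
  ((-1) ^+ (k - i) * kernel_pow K i x y / (i`!%:R * (k - i)`!%:R))).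
  by field; rewrite fi fk bk.
rewrite E (exprNn (N * t)).
by field; rewrite fi fk.
Qed.

Lemma tv_dist_le (mu nu : T -> R) c : 0 <= c ->
  (forall A : {set T}, `|\sum_(x in A) mu x - \sum_(x in A) nu x| <= c) ->
  tv_dist mu nu <= c.
Proof. by move=> c0 H; apply: bigmax_le => // A _. Qed.

Lemma le_tv_dist (mu nu : T -> R) (A : {set T}) :
  `|\sum_(x in A) mu x - \sum_(x in A) nu x| <= tv_dist mu nu.
Proof. exact: (le_bigmax_cond _ (fun A : {set T} => `|\sum_(x in A) mu x - \sum_(x in A) nu x|)). Qed.

End KernelPowers.

(** * From discrepancies to mixing times *)

Section MixingTimes.
Variables (R : realType) (V E : finType) (ends : E -> {set V}) (p q : R).
Variable xi : {set {set V}}.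
Hypothesis endsP : forall e, exists u v, ends e = [set u; v].
Hypotheses (p01 : 0 <= p <= 1) (q1 : 1 <= q) (txi : trivIset xi).
Hypothesis E_gt0 : (0 < #|E|)%N.

Local Notation o := (open_prob ends p q xi).
Local Notation pi := (stationary ends p q xi).

Let o01 w e : 0 <= o w e <= 1. Proof. exact: open_prob01. Qed.
Let o_incr (w w' : {set E}) e : w \subset w' -> o w e <= o w' e.
Proof. exact: open_prob_incr. Qed.

Lemma kernel_pow_fk_step k w w' :
  kernel_pow (fk_step ends p q xi) k w w' = law o [set: E] k w w'.
Proof.
elim: k w => [|k IH] w; first by rewrite kernel_pow0.
rewrite kernel_powS /law stepS -fk_stepE.
by apply: eq_bigr => z _; rewrite IH.
Qed.

Lemma sum_kernel_pow k w (A : {set {set E}}) :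
  \sum_(w' in A) kernel_pow (fk_step ends p q xi) k w w' =
  stepn o [set: E] k (fun w' => (w' \in A)%:R) w.
Proof.
rewrite stepnE /mean [RHS](bigID (mem A))/= [X in _ + X]big1 ?addr0.
  by apply: eq_bigr => w' ->; rewrite mulr1 kernel_pow_fk_step.
by move=> w' /negbTE->; rewrite mulr0.
Qed.

Lemma is_prob_stationary : is_prob pi.
Proof. exact: is_prob_rc_measure. Qed.

(** The whole graph as a subgraph with nothing outside: the boundary condition
    induced by [xi] on all the vertices yields the same components as [xi]. *)
Lemma stationary_invariant : step_invariant o [set: E] pi.
Proof.
have FW e : e \in [set: E] -> ends e \subset [set: V] by rewrite subsetT.
have F0 e : e \in [set: E] -> e \notin (set0 : {set E}) by move=> _; rewrite inE.
pose bc := induced_bc ends [set: V] (set0 : {set E}) xi.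
have wE w : rc_weight ends p q [set: V] [set: E] xi w =
    rc_weight ends p q [set: V] [set: E] bc w.
  rewrite /rc_weight; congr (_ * q ^+ _); apply: eq_n_comp => u v.
  by rewrite (connect_induced set0 txi FW) ?subsetT ?inE// setU0.
have muE w : pi w = rc_measure ends p q [set: V] [set: E] bc w.
  rewrite /stationary /rc_measure wE; congr (if _ then _ / _ else _).
  by apply: eq_bigr => w' _; exact: wE.
have E1 g : mean pi g = mean (extend (rc_measure ends p q [set: V] [set: E] bc) set0) g.
  by rewrite mean_extend; apply: eq_bigr => w _; rewrite setU0 muE.
by move=> g; rewrite !E1; exact: invariant_extend.
Qed.

Lemma kernel_pow_tv k w (A : {set {set E}}) :
  `|\sum_(w' in A) kernel_pow (fk_step ends p q xi) k w w' - \sum_(w' in A) pi w'|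
    <= 2 * \sum_(e : E) gap o k e.
Proof.
have -> : \sum_(w' in A) pi w' = mean pi (fun w' => (w' \in A)%:R).
  rewrite /mean [RHS](bigID (mem A))/= [X in _ + X]big1 ?addr0.
    by apply: eq_bigr => w' ->; rewrite mulr1.
  by move=> w' /negbTE->; rewrite mulr0.
rewrite sum_kernel_pow; apply: stepn_stationary_le => //.
- exact: is_prob_stationary.
- exact: stationary_invariant.
- by move=> w'; case: (w' \in A); rewrite ?lexx ler01.
Qed.

Section SmallGap.
Variable k : nat.
Hypothesis small_gap : forall e, gap o k e <= (16 * #|E|%:R)^-1.

Lemma kernel_pow_tv_small l w (A : {set {set E}}) : (k <= l)%N ->
  `|\sum_(w' in A) kernel_pow (fk_step ends p q xi) l w w' - \sum_(w' in A) pi w'|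
    <= 8^-1.
Proof.
move=> kl; apply: le_trans (kernel_pow_tv l w A) _.
have N0 : 0 < #|E|%:R :> R by rewrite ltr0n.
apply: (@le_trans _ _ (2 * \sum_(e : E) (16 * #|E|%:R)^-1)).
  rewrite ler_wpM2l//; apply: ler_sum => e _.
  by apply: le_trans (small_gap e); exact: gap_decr.
have N1 : #|E|%:R != 0 :> R by rewrite gt_eqF.
rewrite sumr_const -(mulr_natr (_^-1)).
by rewrite (_ : _ * _ = 8^-1)//; field.
Qed.

Lemma tmix_discrete_le : (tmix_discrete ends p q xi <= k%:R%:E)%E.
Proof.
apply: ereal_inf_lbound; exists k => //=.
apply: bigmax_le => [|x0 _]; first by rewrite invr_ge0.
apply: tv_dist_le => [|A]; first by rewrite invr_ge0.
apply: le_trans (kernel_pow_tv_small x0 A (leqnn k)) _.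
lra.
Qed.

Lemma fk_generatorE w w' : fk_generator ends p q xi w w' =
  #|E|%:R * (fk_step ends p q xi w w' - (w' == w)%:R).
Proof.
have N0 : #|E|%:R != 0 :> R by rewrite pnatr_eq0 -lt0n.
rewrite /fk_generator /fk_step mulrBr mulrA mulfV// mul1r sumrB.
by rewrite sumr_const -[X in _ - X]mulr_natl.
Qed.

Lemma kernel_pow_fk_ge0 l w w' : 0 <= kernel_pow (fk_step ends p q xi) l w w'.
Proof.
rewrite kernel_pow_fk_step.
by have [] := is_prob_law o01 E_gt0 [set: E] l w.
Qed.

Lemma sum_kernel_pow_le1 l w (A : {set {set E}}) :
  \sum_(w' in A) kernel_pow (fk_step ends p q xi) l w w' <= 1.
Proof.
rewrite sum_kernel_pow; apply: stepn_le_cst => // w'.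
by rewrite lern1 leq_b1.
Qed.

(** At time [(2 k + 6) / #|E|] the number of jumps is Poisson of mean [2 k + 6], and
    exceeds [k] with large probability. *)
Lemma tmix_continuous_le :
  (tmix_continuous ends p q xi <= ((2 * k + 6)%:R / #|E|%:R)%:E)%E.
Proof.
have N0 : 0 < #|E|%:R :> R by rewrite ltr0n.
apply: ereal_inf_lbound; exists ((2 * k + 6)%:R / #|E|%:R) => //=.
split; first by rewrite divr_ge0.
apply: bigmax_le => [|x0 _]; first by rewrite invr_ge0.
apply: tv_dist_le => [|A]; first by rewrite invr_ge0.
set c : R := (2 * k + 6)%:R; have c0 : 0 <= c by exact: ler0n.
have Nt : #|E|%:R * (c / #|E|%:R) = c by rewrite mulrC divfK// gt_eqF.
pose P := kernel_pow (fk_step ends p q xi).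
have P1 i x y : `|P i x y| <= 1.
  rewrite ger0_norm ?kernel_pow_fk_ge0//.
  by have := sum_kernel_pow_le1 i x [set y]; rewrite big_set1.
have semE y : semigroup (fk_generator ends p q xi) (c / #|E|%:R) x0 y =
    limn (series (fun i => exp_coeff c i * P i x0 y)) * expR (- c).
  have -> : fk_generator ends p q xi =
      (fun w w' => #|E|%:R * (fk_step ends p q xi w w' - (w' == w)%:R)).
    by apply/funext => w; apply/funext => w'; exact: fk_generatorE.
  have H := @semigroup_poisson R {set E} (fk_step ends p q xi) #|E|%:R
    (c / #|E|%:R) x0 y.
  by rewrite Nt in H; exact: H.
under eq_bigr => y _ do rewrite semE.
pose v i := \sum_(y in A) P i x0 y - \sum_(y in A) pi y.
have pi1 : 0 <= \sum_(y in A) pi y <= 1.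
  have [pi0 pi1] := is_prob_stationary.
  rewrite sumr_ge0//= -pi1 [leRHS](bigID (mem A))/= lerDl sumr_ge0//.
have PA1 i : 0 <= \sum_(y in A) P i x0 y <= 1.
  by rewrite sum_kernel_pow_le1 andbT sumr_ge0// => y _; exact: kernel_pow_fk_ge0.
have v1 i : `|v i| <= 1.
  by rewrite /v ler_norml; have := PA1 i; move: pi1; lra.
have := @poisson_average_le _ k v c erefl v1 (fun l kl => kernel_pow_tv_small x0 A kl).
rewrite (_ : limn _ = \sum_(y in A) limn (series (fun i => exp_coeff c i * P i x0 y)) -
  expR c * \sum_(y in A) pi y).
  by rewrite mulrBl mulr_suml mulrAC -expRD subrr expR0 mul1r.
apply/cvg_lim => //.
rewrite (_ : series _ = (fun n => \sum_(y in A) series (fun i => exp_coeff c i * P i x0 y) n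
  - series (exp_coeff c) n * \sum_(y in A) pi y)).
  apply: cvgB; last by apply: cvgMr_tmp; exact: is_cvg_series_exp_coeff.
  apply: cvg_big => [|y _]; first exact: add_continuous.
  exact: cvg_series_weighted.
apply/funext => n; rewrite /series/= exchange_big/= mulr_suml -sumrB.
by apply: eq_bigr => i _; rewrite /v mulrBr mulr_sumr.
Qed.

End SmallGap.
End MixingTimes.

(** * Balls and edges of the box *)

Section Geometry.
Variables (d n : nat).
Local Notation V := (vert d n).
Local Notation edge := (edge d n).
Implicit Types (u v : V) (e f : edge) (r : nat).

Definition shift r (u : V) (s : {ffun 'I_d -> 'I_(r.*2.+1)}) : V :=
  [ffun i => inord (u i + s i - r)%N].

Lemma dist_inftyP r u v :
  reflect (forall i, (`|(u i : nat)%:Z - (v i : nat)%:Z| <= r)%N) (dist_infty u v <= r)%N.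
Proof.
rewrite /dist_infty; apply: (iffP (bigmax_leqP _ _ _)) => H i.
  by have := H i isT; rewrite !ffunE opprB addrA subrK.
by move=> _; have := H i; rewrite !ffunE opprB addrA subrK.
Qed.

Lemma dist_infty_shift r u v : (dist_infty v u <= r)%N ->
  exists s, v = shift u (s : {ffun 'I_d -> 'I_(r.*2.+1)}).
Proof.
move=> /dist_inftyP H; exists [ffun i => inord (v i + r - u i)%N].
apply/ffunP => i; apply/val_inj; rewrite !ffunE /=.
have := H i; have := ltn_ord (v i); have := ltn_ord (u i).
move: (u i : nat) (v i : nat) => a b Ha Hb Hab.
by rewrite (inordK (n' := r.*2)) ?inordK; lia.
Qed.

Lemma card_neighborhood r u :
  (#|[set v | dist_infty v u <= r]| <= r.*2.+1 ^ d)%N.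
Proof.
apply: (@leq_trans #|[set shift u s | s : {ffun 'I_d -> 'I_(r.*2.+1)}]|).
  apply/subset_leq_card/subsetP => v; rewrite inE => /dist_infty_shift[s ->].
  exact: imset_f.
by apply: leq_trans (leq_imset_card _ _) _; rewrite card_ffun !card_ord.
Qed.

Lemma box_endsP e : exists u v, box_ends e = [set u; v] /\ box_adj u v.
Proof.
have /imset2P[u v uV] := valP e; rewrite inE => /andP[_ uv] ee.
by exists u, v.
Qed.

Lemma card_ball_vert r e : (#|ball_vert r e| <= (r.*2.+1 ^ d).*2)%N.
Proof.
have [u [v [eE _]]] := box_endsP e.
apply: (@leq_trans #|[set w | dist_infty w u <= r] :|: [set w | dist_infty w v <= r]|)%N.
  apply/subset_leq_card/subsetP => w; rewrite !inE => /existsP[x].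
  by rewrite eE !inE => /andP[/orP[]/eqP-> ->]; rewrite ?orbT.
by rewrite (leq_trans (leq_card_setU _ _))// -addnn leq_add// card_neighborhood.
Qed.

Lemma box_adj_dist u v : box_adj u v -> (dist_infty v u <= 1)%N.
Proof.
rewrite /box_adj /Zd_adj => /eqP H; apply/dist_inftyP => i.
have : (`|pt u i - pt v i| <= 1)%N.
  by rewrite -H (bigD1 i)//= leq_addr.
by rewrite !ffunE; lia.
Qed.

(** An edge is determined by one of its ends and the displacement to the other. *)
Lemma card_edges_in (W : {set V}) :
  (#|[set f : edge | box_ends f \subset W]| <= #|W| * 3 ^ d)%N.
Proof.
rewrite -(card_imset _ val_inj).
apply: (@leq_trans #|[set [set u; shift (r := 1) u s] | u in W, s in [set: {ffun 'I_d -> 'I_(1.*2.+1)}]]|)%N.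
  apply/subset_leq_card/subsetP => x /imsetP[f]; rewrite inE => fW -> {x}.
  have [u [v [fE uv]]] := box_endsP f.
  have /(dist_infty_shift (r := 1))[s sE] := box_adj_dist uv.
  move: fW; rewrite -[val f]/(box_ends f) fE subUset !sub1set => /andP[uW _].
  by rewrite sE; apply: imset2_f.
rewrite -[leqRHS]mul1n.
apply: leq_trans (_ : _ <= #|setX W [set: {ffun 'I_d -> 'I_3}]|)%N _.
  rewrite curry_imset2X; exact: leq_imset_card.
by rewrite cardsX cardsT card_ffun !card_ord mul1n.
Qed.

Lemma card_ball_edges r e : (#|ball_edges r e| <= (r.*2.+1 ^ d).*2 * 3 ^ d)%N.
Proof.
by apply: leq_trans (card_edges_in _) _; rewrite leq_mul2r card_ball_vert orbT.
Qed.

Lemma card_edge : (#|edge| <= n.+1 ^ d * 3 ^ d)%N.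
Proof.
rewrite -cardsT; have -> : [set: edge] = [set f : edge | box_ends f \subset [set: V]].
  by apply/setP => f; rewrite !inE subsetT.
apply: leq_trans (card_edges_in _) _; rewrite leq_mul2r; apply/orP; right.
rewrite cardsT card_ffun !card_ord.
have : (n./2.*2.+1 <= n.+1)%N by have := odd_double_half n; lia.
by case: (posnP d) => [->//|d0]; rewrite leq_exp2r.
Qed.

Lemma card_edge_gt0 : (0 < d)%N -> (2 <= n)%N -> (0 < #|edge|)%N.
Proof.
move=> d0 n2; pose i0 := Ordinal d0.
pose u : V := [ffun=> ord0]; pose v : V := [ffun i => inord (i == i0)].
have n0 : (1 < n./2.*2.+1)%N by have := odd_double_half n; lia.
have uv : box_adj u v.
  rewrite /box_adj /Zd_adj (bigD1 i0)//= big1 => [|i /negbTE ii0].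
    by rewrite !ffunE eqxx inordK// addn0 opprB addrA subrK.
  by rewrite !ffunE ii0 inordK// subrr.
have ee : [set u; v] \in box_edges d n by apply: imset2_f => //; rewrite inE.
by apply/card_gt0P; exists (Sub [set u; v] ee).
Qed.

Lemma mem_ball_edges r e : e \in ball_edges r e.
Proof.
rewrite inE; apply/subsetP => v ve; rewrite inE; apply/existsP; exists v.
by rewrite ve; apply/dist_inftyP => i; rewrite subrr.
Qed.

End Geometry.

(** * Spatial mixing and the discrepancy at an edge *)

Section SpatialMixing.
Variables (R : realType) (d n : nat) (C p q : R) (xi : {set {set vert d n}}).
Hypotheses (d_gt0 : (0 < d)%N) (n_ge2 : (2 <= n)%N).
Hypotheses (q1 : 1 <= q) (p01 : 0 <= p <= 1).
Hypothesis txi : trivIset xi.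

Local Notation E := (edge d n).
Local Notation ends := (@box_ends d n).
Local Notation o := (open_prob ends p q xi).

Lemma box_ends2 (e : E) : exists u v, ends e = [set u; v].
Proof. by have [u [v [eE _]]] := box_endsP e; exists u, v. Qed.

Let E_gt0 : (0 < #|E|)%N. Proof. exact: card_edge_gt0. Qed.
Let o01 w e : 0 <= o w e <= 1. Proof. exact: open_prob01. Qed.
Let o_incr (w w' : {set E}) e : w \subset w' -> o w e <= o w' e.
Proof. exact: (open_prob_incr box_ends2). Qed.

(** When [p = 0] every update closes its edge. *)
Lemma gap_p0 k e : p = 0 -> gap o k e <= (1 - #|E|%:R^-1) ^+ k.
Proof.
move=> p0.
have o0 w f : o w f = 0 by rewrite /open_prob p0 mul0r if_same.
have N0 : #|E|%:R != 0 :> R by rewrite pnatr_eq0 -lt0n.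
have stepE w : stepn o [set: E] k (opened R e) w =
    (1 - #|E|%:R^-1) ^+ k * opened R e w.
  elim: k w => [|k IH] w; first by rewrite expr0 mul1r.
  rewrite stepS (step_eq o [set: E] IH) /step /upd exprS.
  rewrite (bigD1 e)//= inE o0 mul0r add0r subr0 mul1r /opened !inE eqxx mulr0 add0r.
  rewrite (eq_bigr (fun=> (1 - #|E|%:R^-1) ^+ k * (e \in w)%:R)); last first.
    by move=> f fe; rewrite inE o0 mul0r add0r subr0 mul1r !inE eq_sym fe.
  rewrite sumr_const.
  have -> : #|(fun i : E => i != e)| = #|E|.-1.
    by rewrite -(cardsC1 e); apply: eq_card => f; rewrite !inE.
  rewrite -(mulr_natl (_ * _)) -subn1 natrB//; by field.
rewrite /gap !stepE /opened !inE mulr0 subr0 mulr1 lexx//.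
Qed.

Section Ball.
Variables (m : nat) (e : E).
Local Notation B := (ball_edges m e).

Definition wired_ball := extend (ball_measure p q xi m e (~: B)) (~: B).
Definition free_ball := extend (ball_measure p q xi m e set0) set0.

Lemma ball_edges_sub f : f \in B -> ends f \subset ball_vert m e.
Proof. by rewrite inE. Qed.

Lemma wired_ball_prob : is_prob wired_ball.
Proof. exact/is_prob_extend/is_prob_rc_measure. Qed.

Lemma free_ball_prob : is_prob free_ball.
Proof. exact/is_prob_extend/is_prob_rc_measure. Qed.

Lemma wired_ball_inv : step_invariant o B wired_ball.
Proof.
apply: (invariant_extend box_ends2) => //; first exact: ball_edges_sub.
by move=> f fB; rewrite inE fB.
Qed.

Lemma free_ball_inv : step_invariant o B free_ball.
Proof.
apply: (invariant_extend box_ends2) => //; first exact: ball_edges_sub.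
by move=> f fB; rewrite inE.
Qed.

Lemma wired_ball_supp w : wired_ball w != 0 -> ~: B \subset w.
Proof. by move=> /extend_supp[w' _ ->]; exact: subsetUr. Qed.

Lemma free_ball_supp w : free_ball w != 0 -> w \subset B.
Proof.
move=> /extend_supp[w' w'0 ->]; rewrite setU0.
by apply: contraNT w'0 => w'B; rewrite /ball_measure rc_measure_out.
Qed.

Lemma marginal_opened (mu : {set E} -> R) (F : {set E}) : e \in F ->
  \sum_(eta in [set eta : {set E} | e \in eta]) marginal mu F eta =
  \sum_w mu w * (e \in w)%:R.
Proof.
move=> eF; rewrite /marginal.
rewrite [RHS](partition_big (fun w => w :&: F) predT)//= [RHS](bigID (mem [set eta : {set E} | e \in eta]))/=.
rewrite [X in _ + X]big1 ?addr0 => [|eta].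
  apply: eq_bigr => eta; rewrite inE => eeta; apply: eq_bigr => w /eqP wE.
  by move: eeta; rewrite -wE inE => /andP[-> _]; rewrite mulr1.
rewrite inE => eeta; rewrite big1// => w /eqP wE.
by move: eeta; rewrite -wE inE eF andbT => /negbTE->; rewrite mulr0.
Qed.

Hypothesis ssm : SSM p q xi C.
Hypothesis mn : (2 * m <= n)%N.

(** The edge [e] lies in the inner ball, so spatial mixing applies to the event
    that [e] is open. *)
Lemma ssm_opened :
  mean wired_ball (opened R e) - mean free_ball (opened R e) <=
  C * expR (- (m%:R / C)).
Proof.
have eB : e \in B by exact: mem_ball_edges.
have eB2 : e \in ball_edges m./2 e by exact: mem_ball_edges.
have E1 : mean wired_ball (opened R e) =
    \sum_w ball_measure p q xi m e (~: B) w * (e \in w)%:R.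
  rewrite mean_extend; apply: eq_bigr => w _; congr (_ * _%:R).
  by rewrite in_setU in_setC eB orbF.
have E0 : mean free_ball (opened R e) =
    \sum_w ball_measure p q xi m e set0 w * (e \in w)%:R.
  by rewrite mean_extend; apply: eq_bigr => w _; rewrite setU0.
have {}E1 := etrans E1 (esym (marginal_opened (ball_measure p q xi m e (~: B)) eB2)).
have {}E0 := etrans E0 (esym (marginal_opened (ball_measure p q xi m e set0) eB2)).
rewrite E1 E0; apply: le_trans (ssm e mn).
exact: le_trans (ler_norm _) (le_tv_dist _ _ _).
Qed.

Hypothesis p_gt0 : 0 < p.
Local Notation a := (p / (q * (1 - p) + p)).

Let a_gt0 : 0 < a.
Proof. by rewrite divr_gt0// bridge_den_gt0. Qed.

Lemma gap_sweeps_ball b j : (#|B| <= b)%N ->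
  gap o (j * (b * #|E|)) e <=
    C * expR (- (m%:R / C)) + 2 * (1 - (a / 2) ^+ b) ^+ j.
Proof.
move=> Bb; apply: le_trans (_ : _ <= _ + 2 * (1 - (a / 2) ^+ b) ^+ j) _.
  apply: (gap_sweeps o01 o_incr E_gt0 (ltW a_gt0) _ wired_ball_prob wired_ball_inv
    wired_ball_supp free_ball_prob free_ball_inv free_ball_supp j e Bb).
  exact: open_prob_ge.
by rewrite lerD2r; exact: ssm_opened.
Qed.

Lemma gap_double_ball s (r : R) : (forall e', gap o s e' <= r) ->
  gap o (s + s) e <= #|B|%:R * r * r + C * expR (- (m%:R / C)).
Proof.
move=> Hs.
have a_le w f : a <= o w f by exact: open_prob_ge.
have := gap_add o01 o_incr E_gt0 (ltW a_gt0) a_le (is_prob_stationary ends xi p01 q1)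
  (stationary_invariant box_ends2 p01 q1 txi E_gt0) wired_ball_prob wired_ball_inv
  wired_ball_supp free_ball_prob free_ball_inv free_ball_supp a_gt0 Hs (Hs e).
by move/le_trans; apply; rewrite lerD2l; exact: ssm_opened.
Qed.

End Ball.
End SpatialMixing.

(** * Doubling times and scales *)

Section Growth.
Variable R : realType.

Lemma poly_le_expR (K c : R) d : 0 < c ->
  exists M : nat, forall m : nat, (M <= m)%N -> K * m%:R ^+ d <= expR (c * m%:R).
Proof.
move=> c0; pose b := (c / d.+1%:R) ^+ d.+1.
have b0 : 0 < b by rewrite exprn_gt0// divr_gt0// ltr0n.
exists (Num.truncn (K / b)).+1 => m Mm.
have Km : K <= b * m%:R.
  rewrite mulrC -ler_pdivrMr//; apply: ltW; apply: lt_le_trans (truncnS_gt _) _.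
  by rewrite ler_nat.
apply: (@le_trans _ _ ((c * m%:R / d.+1%:R) ^+ d.+1)).
  rewrite mulrAC exprMn -/b [m%:R ^+ d.+1]exprS mulrA.
  by rewrite ler_wpM2r// exprn_ge0.
have d0 : d.+1%:R != 0 :> R by rewrite pnatr_eq0.
rewrite [in leRHS](_ : c * m%:R = d.+1%:R * (c * m%:R / d.+1%:R)); last first.
  by rewrite [RHS]mulrC divfK.
rewrite expRM_natl lerXn2r// ?nnegrE ?expR_ge0//.
  by rewrite divr_ge0// mulr_ge0// ltW.
by apply: le_trans (expR_ge1Dx _); rewrite lerDr.
Qed.

Lemma exists_geometric_le (r eps : R) : 0 <= r < 1 -> 0 < eps ->
  exists j : nat, 2 * r ^+ j <= eps.
Proof.
move=> r01 eps0; apply: contrapT => /forallNP H.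
suff : eps <= 0 by rewrite leNgt eps0.
apply: (le_add_geometric r01 (c := 2)) => j; rewrite add0r.
by have /negP := H j; rewrite -ltNge => /ltW.
Qed.

End Growth.

Lemma ball_volume_le d m : (0 < d)%N -> (0 < m)%N ->
  ((m.*2.+1 ^ d).*2 * 3 ^ d <= 2 * 9 ^ d * m ^ d)%N.
Proof.
move=> d0 m0.
have : (m.*2.+1 ^ d <= 3 ^ d * m ^ d)%N by rewrite -expnMn leq_exp2r//; lia.
rewrite -muln2 -[9%N]/(3 * 3)%N expnMn.
by move: (3 ^ d)%N (m ^ d)%N (m.*2.+1 ^ d)%N => Y X W; nia.
Qed.

Section Decay.
Variables (R : realType) (d : nat) (C p q : R).
Hypotheses (C_gt0 : 0 < C) (d_gt0 : (0 < d)%N) (q1 : 1 <= q).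

(** Doubling the time squares the discrepancy, up to the size of a ball and to
    the mixing error at its radius; letting the radius double along with the
    time keeps both corrections harmless. *)
Lemma gap_decay : 0 < p <= 1 -> exists n0 M T : nat,
  forall n : nat, (n0 <= n)%N -> forall xi : {set {set vert d n}},
  trivIset xi -> SSM p q xi C -> forall j, (2 * (M * 2 ^ j) <= n)%N ->
  forall e, gap (open_prob (@box_ends d n) p q xi)
    (2 ^ j * (T * #|edge d n|)) e <= expR (- (2 ^ j)%:R).
Proof.
move=> /andP[p_gt0 p_le1]; have p01 : 0 <= p <= 1 by rewrite ltW.
(* A ball of radius [m > 0] has at most [A * m ^ d] edges. The discrepancy is
   bounded by [exp(- 2 ^ i) / (Z * m ^ d)] with [m = M * 2 ^ i]: the choice of [Z]
   makes [A * m ^ d / (Z * m ^ d) ^ 2] half of [1 / (Z * (2 * m) ^ d)], the other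
   half being left for the mixing error. *)
pose A : R := (2 * 9 ^ d)%:R; pose Z : R := 2 * 2 ^+ d * A.
have A0 : 0 < A by rewrite ltr0n muln_gt0 expn_gt0.
have Z0 : 0 < Z by rewrite !mulr_gt0// exprn_gt0.
have Z1 : 1 <= Z.
  by rewrite /Z /A -!natrX -!natrM ler1n !muln_gt0 !expn_gt0.
(* [M1] makes the mixing error small compared to the polynomial factor, and
   [4 C <= M] makes it small compared to [exp(- 2 ^ i)]. *)
have [M1 HM1] := @poly_le_expR R (2 * C * Z * 2 ^+ d) (2 * C)^-1 d
  ltac:(by rewrite invr_gt0 mulr_gt0).
pose M := maxn M1 (Num.truncn (4 * C)).+1.
have M0 : (0 < M)%N by rewrite leq_max orbT.
have MC : 4 * C <= M%:R.
  apply: ltW; apply: lt_le_trans (truncnS_gt _) _.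
  by rewrite ler_nat leq_max leqnn orbT.
(* [eps] is the bound for [i = 0]; half of it comes from the mixing error at
   radius [m0] and half from the relaxation of the ball of that radius. *)
pose eps : R := expR (- 1) / (Z * M%:R ^+ d).
have eps0 : 0 < eps.
  by rewrite divr_gt0 ?expR_gt0// mulr_gt0// exprn_gt0// ltr0n.
have [m0 /(_ _ (leqnn _)) Hm0] := @poly_le_expR R (2 * C / eps) C^-1 0
  ltac:(by rewrite invr_gt0).
pose b0 := ((m0.*2.+1 ^ d).*2 * 3 ^ d)%N.
pose a := p / (q * (1 - p) + p).
have a0 : 0 < a by rewrite divr_gt0// bridge_den_gt0.
have a1 : a <= 1 by apply: le_trans p_le1; exact: bridge_prob_le.
have r01 : 0 <= 1 - (a / 2) ^+ b0 < 1.
  have a2 : 0 < a / 2 by rewrite divr_gt0.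
  by rewrite gtrBl exprn_gt0// subr_ge0 exprn_ile1 ?ltW// ltr_pdivrMr//; lra.
have [J HJ] := exists_geometric_le r01 (divr_gt0 eps0 (ltr0n R 2)).
exists (maxn 2 (2 * m0)), M, (J * b0)%N => n.
rewrite geq_max => /andP[n2 nm0] xi txi ssm j Mj e.
have := leqnn j; set N := #|edge d n|.
suff claim i : (i <= j)%N -> forall e, gap (open_prob (@box_ends d n) p q xi)
    (2 ^ i * (J * b0 * N)) e <= expR (- (2 ^ i)%:R) / (Z * (M * 2 ^ i)%:R ^+ d).
  move=> jj; apply: le_trans (claim j jj e) _.
  rewrite ler_pdivrMr ?mulr_gt0 ?exprn_gt0 ?ltr0n ?muln_gt0 ?M0 ?expn_gt0//.
  rewrite ler_peMr ?expR_ge0// -[leLHS]mulr1 ler_pM//.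
  by rewrite -natrX ler1n expn_gt0 muln_gt0 M0 expn_gt0.
elim: i => [_ e'|i IH ij e'].
  rewrite expn0 mul1n muln1 -mulnA -/eps.
  apply: le_trans (gap_sweeps_ball d_gt0 n2 q1 p01 txi ssm nm0 p_gt0 _ _) _.
    exact: card_ball_edges.
  have : C * expR (- (m0%:R / C)) <= eps / 2.
    rewrite expRN ler_pdivrMr ?expR_gt0//.
    move: Hm0; rewrite expr0 mulr1 [C^-1 * _]mulrC ler_pdivrMr//; lra.
  have := HJ; rewrite -/a; lra.
have ij' := ltnW ij; set m := (M * 2 ^ i)%N.
have mn : (2 * m <= n)%N.
  apply: leq_trans Mj; rewrite !leq_mul2l /=; apply/orP; right.
  by rewrite leq_exp2l.
rewrite expnS mul2n -addnn mulnDl.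
apply: le_trans (gap_double_ball d_gt0 n2 q1 p01 txi e' ssm mn p_gt0 (IH ij')) _.
rewrite -/m; set y := expR (- (2 ^ i)%:R); pose x : R := m%:R ^+ d.
have m1 : (0 < m)%N by rewrite muln_gt0 M0 expn_gt0.
have x0 : 0 < x by rewrite exprn_gt0// ltr0n.
have y0 : 0 < y by exact: expR_gt0.
have Bx : #|ball_edges m e'|%:R <= A * x.
  rewrite /A /x -natrX -natrM ler_nat; apply: leq_trans (card_ball_edges _ _) _.
  exact: ball_volume_le.
have -> : expR (- (2 ^ i + 2 ^ i)%:R) = y ^+ 2.
  by rewrite natrD opprD expRD expr2.
have -> : ((M * (2 ^ i + 2 ^ i))%:R : R) ^+ d = 2 ^+ d * x.
  by rewrite addnn -mul2n mulnCA natrM exprMn.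
have h1 : #|ball_edges m e'|%:R * (y / (Z * x)) * (y / (Z * x)) <=
    (y ^+ 2 / (Z * (2 ^+ d * x))) / 2.
  apply: (@le_trans _ _ (A * x * (y / (Z * x)) * (y / (Z * x)))).
    by rewrite !ler_wpM2r// divr_ge0 ?ltW// mulr_gt0.
  have d2 : (2 : R) ^+ d != 0 by rewrite gt_eqF// exprn_gt0.
  rewrite le_eqVlt; apply/orP; left; apply/eqP; rewrite /Z.
  by field; rewrite d2 !gt_eqF.
have h2 : C * expR (- (m%:R / C)) <= (y ^+ 2 / (Z * (2 ^+ d * x))) / 2.
  have Mm : (M1 <= m)%N.
    by apply: (@leq_trans M); [exact: leq_maxl|rewrite /m leq_pmulr// expn_gt0].
  have := HM1 m Mm; rewrite -/x => H.
  have d2 : 0 < (2 : R) ^+ d by rewrite exprn_gt0.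
  rewrite -mulrA -invfM ler_pdivlMr ?mulr_gt0// expRN mulrAC.
  rewrite ler_pdivrMr ?expR_gt0//.
  apply: (@le_trans _ _ (2 * C * Z * 2 ^+ d * x)).
    by rewrite le_eqVlt; apply/orP; left; apply/eqP; ring.
  apply: le_trans H _; rewrite /y -expRM_natl -expRD ler_expR.
  have iC : (2 * C)^-1 * m%:R * 2 = m%:R / C.
    by field; rewrite gt_eqF.
  have : 4 * (2 ^ i)%:R <= m%:R / C.
    rewrite ler_pdivlMr// /m natrM -mulrA [_ * C]mulrC mulrA ler_wpM2r//.
  lra.
by lra.
Qed.

End Decay.

Lemma gap_decay_p0 (R : realType) (d : nat) (q : R) : (0 < d)%N ->
  forall n : nat, (2 <= n)%N -> forall (xi : {set {set vert d n}}) j e,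
  gap (open_prob (@box_ends d n) 0 q xi) (2 ^ j * #|edge d n|) e
    <= expR (- (2 ^ j)%:R).
Proof.
move=> d0 n n2 xi j e; apply: le_trans (@gap_p0 R d n 0 q xi d0 n2 _ e erefl) _.
have E0 := card_edge_gt0 d0 n2; set N := #|edge d n|.
have N0 : 0 < N%:R :> R by rewrite ltr0n.
apply: (@le_trans _ _ (expR (- N%:R^-1) ^+ (2 ^ j * N))).
  rewrite lerXn2r ?nnegrE ?expR_ge0 ?subr_ge0 ?invf_le1// ?ler1n//.
  exact: expR_ge1Dx.
by rewrite -expRM_natl natrM mulrN mulfK// gt_eqF.
Qed.

(** The round [j] at which to stop: [2 ^ j] is of order [log n], but [exp(2 ^ j)]
    exceeds [16] times the number of edges, of order [n ^ d]. *)
Lemma scale_bounds (d n : nat) : (0 < d)%N -> (2 <= n)%N ->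
  let l := trunc_log 2 n in
  exists j : nat, [/\ (2 ^ j <= 18 * (d * l))%N
    & (16 * (n.+1 ^ d * 3 ^ d) <= 2 ^ (2 ^ j))%N].
Proof.
move=> d0 n2 l; have /andP[ln nl] : (2 ^ l <= n < 2 ^ l.+1)%N.
  by apply: trunc_log_bounds => //; apply: ltn_trans n2.
have l0 : (0 < l)%N by rewrite trunc_log_gt0.
pose X := (4 + 4 * d + d * l)%N; exists (up_log 2 X); split.
  have /andP[Xj _] := @up_log_bounds 2 X isT ltac:(by rewrite /X !addSn).
  apply: (@leq_trans (2 * X)); last by rewrite /X; nia.
  apply: (@leq_trans (2 * 2 ^ (up_log 2 X).-1)).
    by case: (up_log 2 X) => [//|k]; rewrite expnS.
  by rewrite leq_mul2l/= ltnW.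
apply: (@leq_trans (2 ^ X)); last by rewrite leq_exp2l//; exact: up_logP.
have n1 : (n.+1 ^ d <= 2 ^ (d * l.+1))%N.
  by rewrite mulnC expnM leq_exp2r.
have n3 : (3 ^ d <= 2 ^ (2 * d))%N by rewrite expnM leq_exp2r.
apply: (@leq_trans (2 ^ 4 * (2 ^ (d * l.+1) * 2 ^ (2 * d)))).
  by rewrite leq_mul2l leq_mul.
by rewrite -!expnD leq_exp2l// /X; lia.
Qed.

Lemma affine_le_prod (a b t : nat) : (0 < a)%N -> (0 < b)%N ->
  (2 * (a * (t * b)) + 6 <= a * (2 * t + 6) * b)%N.
Proof.
move=> a0 b0; have ab : (1 <= a * b)%N by rewrite muln_gt0 a0.
have -> : (a * (2 * t + 6) * b = 2 * (a * (t * b)) + 6 * (a * b))%N by ring.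
by rewrite leq_add2l -[leqLHS]muln1 leq_mul2l.
Qed.

Theorem theorem1p2 (R : realType) (C : R) (d : nat) (q p : R) :
  0 < C -> (2 <= d)%N -> 1 <= q -> 0 <= p <= 1 ->
  exists (n0 : nat) (K : R),
  forall n : nat, (n0 <= n)%N ->
  forall xi : {set {set vert d n}},
    finset.partition xi (box_boundary d n) ->
    SSM p q xi C ->
    let N : R := (n ^ d)%:R in
    (tmix_continuous (@box_ends d n) p q xi <= (K * ln N)%:E)%E /\
    (tmix_discrete (@box_ends d n) p q xi <= (K * (N * ln N))%:E)%E.
Proof.
move=> C0 d2 q1 p01; have d0 : (0 < d)%N by exact: ltnW.
have [n0 [M [T decay]]] : exists n0 M T : nat,
  forall n : nat, (n0 <= n)%N -> forall xi : {set {set vert d n}},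
  trivIset xi -> SSM p q xi C -> forall j, (2 * (M * 2 ^ j) <= n)%N ->
  forall e, gap (open_prob (@box_ends d n) p q xi)
    (2 ^ j * (T * #|edge d n|)) e <= expR (- (2 ^ j)%:R).
  have [p0|p_neq0] := eqVneq p 0.
    exists 2, 1%N, 1%N => n n2 xi _ _ j _ e; rewrite mul1n p0.
    exact: gap_decay_p0.
  apply: gap_decay => //; move: p01 => /andP[p0 ->].
  by rewrite lt_neqAle eq_sym p_neq0 p0.
have ln2 : 0 < ln 2 :> R by rewrite ln_gt0// ltr1n.
have [l0 Hl0] := @poly_le_expR R (36 * M * d)%:R (ln 2) 1 ln2.
pose kappa : R := 18 / ln 2.
have kappa0 : 0 < kappa by rewrite divr_gt0.
exists (maxn (maxn n0 2) (2 ^ l0)), (kappa * ((2 * T + 6) * 6 ^ d)%:R).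
move=> n; rewrite !geq_max => /andP[/andP[n0n n2] l0n] xi pxi ssm N.
have txi : trivIset xi by case/and3P: pxi.
have E0 := card_edge_gt0 d0 n2.
have [j [j18 jN]] := scale_bounds d0 n2; move: j18; set l := trunc_log 2 n => j18.
have ll : (l0 <= l)%N by exact: trunc_log_max.
have ln_le : (2 ^ l <= n)%N by rewrite trunc_logP// ltnW.
have Mj : (2 * (M * 2 ^ j) <= n)%N.
  apply: leq_trans ln_le; rewrite -(ler_nat R) natrX.
  apply: le_trans (_ : _ <= (36 * M * d)%:R * l%:R ^+ 1) _.
    by rewrite expr1 -natrM ler_nat; clear -j18; nia.
  by apply: le_trans (Hl0 l ll) _; rewrite expRM_natr lnK// posrE.
have jlnN : (2 ^ j)%:R <= kappa * ln N.
  have lnN : (d * l)%:R * ln 2 <= ln N.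
    rewrite mulr_natl -lnXn// ler_ln ?posrE ?exprn_gt0 ?ltr0n ?expn_gt0 ?(ltnW n2)//.
    by rewrite /N -natrX ler_nat mulnC expnM leq_exp2r.
  rewrite /kappa mulrAC ler_pdivlMr//.
  apply: le_trans (_ : _ <= (18 * (d * l))%:R * ln 2) _.
    by rewrite ler_wpM2r ?(ltW ln2)// ler_nat.
  by rewrite natrM -mulrA ler_wpM2l.
have EN : #|edge d n|%:R <= (6 ^ d)%:R * N.
  rewrite /N -natrM ler_nat; apply: leq_trans (card_edge d n) _.
  by rewrite -!expnMn leq_exp2r//; clear -n2; lia.
have small e : gap (open_prob (@box_ends d n) p q xi)
    (2 ^ j * (T * #|edge d n|)) e <= (16 * #|edge d n|%:R)^-1.
  apply: le_trans (decay n n0n xi txi ssm j Mj e) _.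
  rewrite expRN lef_pV2 ?posrE ?expR_gt0 ?mulr_gt0 ?ltr0n//.
  apply: (@le_trans _ _ ((2 ^ (2 ^ j))%:R)).
    rewrite -[16]/(16%:R) -natrM ler_nat; apply: leq_trans jN.
    by rewrite leq_mul2l/= card_edge.
  rewrite natrX -(mulr1 (2 ^ j)%:R) expRM_natl lerXn2r ?nnegrE ?expR_ge0//.
  exact: expR_ge1Dx.
have lnN0 : 0 <= ln N.
  by have := le_trans (ler0n R (2 ^ j)) jlnN; rewrite pmulr_rge0.
have j1 : 1 <= (2 ^ j)%:R :> R by rewrite ler1n expn_gt0.
split.
  apply: le_trans (tmix_continuous_le (@box_ends2 d n) p01 q1 txi E0 small) _.
  have Ne : 0 < #|edge d n|%:R :> R by rewrite ltr0n.
  rewrite lee_fin ler_pdivrMr//.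
  apply: (@le_trans _ _ ((2 ^ j)%:R * (2 * T + 6)%:R * #|edge d n|%:R)).
    by rewrite -!natrM ler_nat affine_le_prod// expn_gt0.
  rewrite ler_wpM2r// natrM.
  have T6 : 0 <= (2 * T + 6)%:R :> R by exact: ler0n.
  have d6 : 1 <= (6 ^ d)%:R :> R by rewrite ler1n expn_gt0.
  apply: (@le_trans _ _ (kappa * ln N * (2 * T + 6)%:R)); first by rewrite ler_wpM2r.
  have kT : 0 <= kappa * ln N * (2 * T + 6)%:R.
    exact: mulr_ge0 (mulr_ge0 (ltW kappa0) lnN0) T6.
  have -> : kappa * ((2 * T + 6)%:R * (6 ^ d)%:R) * ln N =
    kappa * ln N * (2 * T + 6)%:R * (6 ^ d)%:R by ring.
  by rewrite ler_peMr.
apply: le_trans (tmix_discrete_le (@box_ends2 d n) p01 q1 txi E0 small) _.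
rewrite lee_fin 2!natrM.
apply: (@le_trans _ _ (kappa * ln N * (T%:R * ((6 ^ d)%:R * N)))).
  apply: ler_pM => //; rewrite ?mulr_ge0 ?ler_wpM2l//.
have T6 : T%:R <= (2 * T + 6)%:R :> R by rewrite ler_nat mul2n -addnn -addnA leq_addr.
have H : 0 <= kappa * ln N * ((6 ^ d)%:R * N).
  by rewrite mulr_ge0 ?(mulr_ge0 (ltW kappa0) lnN0)// mulr_ge0.
rewrite natrM.
have -> : kappa * ln N * (T%:R * ((6 ^ d)%:R * N)) =
  kappa * ln N * ((6 ^ d)%:R * N) * T%:R by ring.
have -> : kappa * ((2 * T + 6)%:R * (6 ^ d)%:R) * (N * ln N) =
  kappa * ln N * ((6 ^ d)%:R * N) * (2 * T + 6)%:R by ring.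
exact: ler_wpM2l.
Qed.
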